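(* For any natural number $d\ge2$ there exists a compactly supported vector field $v\in L^\infty(\mathbb{R}^d;\mathbb{R}^d)$ with $\operatorname{div} v=0$ in the sense of distributions such that the operator $\mathsf{A}(\rho)=v\cdot\nabla\rho$ with domain $D(\mathsf{A})=C_0^\infty(\mathbb{R}^d)$ is not essentially skew adjoint on $L^2(\mathbb{R}^d)$.
   Context: $C_0^\infty(\mathbb{R}^d)$ is the space of compactly supported smooth functions. The operator $\mathsf{A}$ is regarded as an unbounded densely defined operator on $L^2(\mathbb{R}^d)$; it is essentially skew adjoint if $\mathsf{A}^*=-\overline{\mathsf{A}}$, where $\overline{\mathsf{A}}$ denotes the closure of $\mathsf{A}$. *)

(* Defs.v *)
From HB Require Import structures.
From mathcomp Require Import all_boot all_order all_algebra.
From mathcomp Require Import all_classical all_reals all_analysis.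

Set Implicit Arguments.
Unset Strict Implicit.
Unset Printing Implicit Defensive.

Import Order.TTheory GRing.Theory Num.Theory.
Import numFieldNormedType.Exports.

Local Open Scope classical_set_scope.
Local Open Scope ring_scope.

(* The sigma-algebra of R^n generated by the coordinates, as in the library's
   instance for n.-tuple T; for n-dimensional row vectors over R it is the
   Borel sigma-algebra. *)
Definition rV_display : measure_display.
Proof. exact: default_measure_display. Qed.

Section measurable_rV.
Variables (R : realType) (n : nat).

Let coors : 'I_n -> 'rV[R]_n -> measurableTypeR R := fun i x => x ord0 i.

Let rV_set0 : g_sigma_preimage coors set0.
Proof. exact: sigma_algebra0. Qed.

Let rV_setC A : g_sigma_preimage coors A -> g_sigma_preimage coors (~` A).
Proof. exact: sigma_algebraC. Qed.

Let rV_bigcup (F : (set 'rV[R]_n)^nat) :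
  (forall i, g_sigma_preimage coors (F i)) ->
  g_sigma_preimage coors (\bigcup_i F i).
Proof. exact: sigma_algebra_bigcup. Qed.

HB.instance Definition _ := @isMeasurable.Build rV_display
  'rV[R]_n (g_sigma_preimage coors) rV_set0 rV_setC rV_bigcup.

Lemma measurable_rV_coor (i : 'I_n) :
  measurable_fun [set: 'rV[R]_n] (fun x => x ord0 i : measurableTypeR R).
Proof.
move=> _ Y mY; rewrite setTI; apply: sub_sigma_algebra.
rewrite -bigcup_seq/=; exists i => /=; first by rewrite mem_index_enum.
by exists Y => //; rewrite setTI.
Qed.

Lemma measurable_fun_rVP d (T : measurableType d) (f : T -> 'rV[R]_n) :
  (forall i, measurable_fun [set: T] (fun t => f t ord0 i : measurableTypeR R)) ->
  measurable_fun [set: T] f.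
Proof.
move=> mf _ A mA; rewrite setTI.
have : preimage_set_system [set: T] f (@measurable _ 'rV[R]_n) (f @^-1` A).
  by exists A => //; rewrite setTI.
rewrite /measurable/= -g_sigma_preimage_comp => H.
apply: (smallest_sub _ _ H); first exact: sigma_algebra_measurable.
rewrite -bigcup_seq/=; apply: bigcup_sub => i _ _ [B mB <-].
exact: mf.
Qed.

End measurable_rV.

Section lebesgue_rV_cons.
Variables (R : realType) (n : nat).

Definition rV_cons (p : measurableTypeR R * 'rV[R]_n) : 'rV[R]_n.+1 :=
  row_mx (p.1 : R)%:M p.2.

Lemma measurable_rV_cons : measurable_fun [set: _] rV_cons.
Proof.
apply: measurable_fun_rVP => i.
case: (split_ordP (i : 'I_(1 + n))) => j ->.
  have -> : (fun t => rV_cons t ord0 (lshift n j) : measurableTypeR R) = fst.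
    by apply/funext => t; apply: etrans (row_mxEl _ _ _ _) _; rewrite !ord1 mxE.
  exact: measurable_fst.
have -> : (fun t => rV_cons t ord0 (rshift 1 j) : measurableTypeR R) =
    (fun x : 'rV[R]_n => x ord0 j : measurableTypeR R) \o snd.
  by apply/funext => t; exact: row_mxEr.
by apply: measurableT_comp => //; exact: measurable_rV_coor.
Qed.

Variable m : {sigma_finite_measure set 'rV[R]_n -> \bar R}.

Definition lebesgue_rV_cons : set 'rV[R]_n.+1 -> \bar R :=
  pushforward (@lebesgue_measure R \x m)%E rV_cons.

Let lebesgue_rV_cons0 : lebesgue_rV_cons set0 = 0%E.
Proof. by rewrite /lebesgue_rV_cons /pushforward preimage_set0 measure0. Qed.

Let lebesgue_rV_cons_ge0 A : (0 <= lebesgue_rV_cons A)%E.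
Proof. by rewrite /lebesgue_rV_cons /pushforward; apply: measure_ge0. Qed.

Let lebesgue_rV_cons_sigma_additive : semi_sigma_additive lebesgue_rV_cons.
Proof.
move=> F mF tF mUF; rewrite /lebesgue_rV_cons /pushforward preimage_bigcup.
have mp A : measurable A -> measurable (rV_cons @^-1` A).
  by move=> mA; have := measurable_rV_cons measurableT mA; rewrite setTI.
apply: measure_semi_sigma_additive => [i||]; first exact: mp.
- apply/trivIsetP => /= i j _ _ ij; rewrite -preimage_setI.
  by move/trivIsetP : tF => /(_ _ _ I I ij) ->; rewrite preimage_set0.
- by rewrite -preimage_bigcup; exact: mp.
Qed.

HB.instance Definition _ := isMeasure.Build _ _ _ lebesgue_rV_cons
  lebesgue_rV_cons0 lebesgue_rV_cons_ge0 lebesgue_rV_cons_sigma_additive.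

Let lebesgue_rV_cons_sigma_finite : sigma_finite setT lebesgue_rV_cons.
Proof.
have /sigma_finiteP[F [TF ndF Foo]] := sigma_finiteT (@lebesgue_measure R).
have /sigma_finiteP[G [TG ndG Goo]] := sigma_finiteT m.
pose uncons (x : 'rV[R]_(1 + n)) : measurableTypeR R * 'rV[R]_n :=
  (x ord0 (lshift n ord0), rsubmx x).
have consK : cancel rV_cons uncons.
  by move=> [a x]; rewrite /uncons row_mxKr row_mxEl mxE.
have unconsK : cancel uncons rV_cons.
  move=> x; rewrite /rV_cons /= -[RHS]hsubmxK; congr row_mx.
  by apply/rowP => j; rewrite !ord1 !mxE mulr1n.
have uncons_m : measurable_fun [set: 'rV[R]_n.+1] uncons.
  apply/measurable_fun_pair; first exact: measurable_rV_coor.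
  apply: measurable_fun_rVP => i.
  have -> : (fun t : 'rV[R]_(1 + n) => (rsubmx t) ord0 i : measurableTypeR R) =
      (fun t => t ord0 (rshift 1 i)) by apply/funext => t; rewrite mxE.
  exact: measurable_rV_coor.
exists (fun k => uncons @^-1` (F k `*` G k)).
  rewrite -preimage_bigcup (_ : \bigcup_k (F k `*` G k) = setT)//.
  apply/seteqP; split => // -[x y] _.
  have [i _ Fix] : (\bigcup_i F i) x by rewrite -TF.
  have [j _ Gjy] : (\bigcup_i G i) y by rewrite -TG.
  exists (maxn i j) => //; split.
    by move: x Fix; exact/subsetPset/ndF/leq_maxl.
  by move: y Gjy; exact/subsetPset/ndG/leq_maxr.
move=> k; have [mFk Fkoo] := Foo k; have [mGk Gkoo] := Goo k; split.
  by have := uncons_m measurableT _ (measurableX mFk mGk); rewrite setTI.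
rewrite /lebesgue_rV_cons /pushforward -comp_preimage.
rewrite (_ : uncons \o rV_cons = id); last exact/funext.
by rewrite preimage_id product_measure1E// lte_mul_pinfty// ge0_fin_numE.
Qed.

HB.instance Definition _ := Measure_isSigmaFinite.Build _ _ _ lebesgue_rV_cons
  lebesgue_rV_cons_sigma_finite.

End lebesgue_rV_cons.

(* Lebesgue measure on R^n: the unit mass at the only point of R^0, and the
   product of the Lebesgue measures on R and on R^n transported to R^(n+1). *)
Fixpoint lebesgue_rV (R : realType) (n : nat) :
    {sigma_finite_measure set 'rV[R]_n -> \bar R} :=
  match n with
  | 0 => [the {sigma_finite_measure set 'rV[R]_0 -> \bar R} of \d_ (0 : 'rV[R]_0)]
  | n'.+1 => [the {sigma_finite_measure set 'rV[R]_n'.+1 -> \bar R} of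
              lebesgue_rV_cons (lebesgue_rV R n')]
  end.

Lemma lebesgue_rV_box (R : realType) n (A : 'I_n -> set (measurableTypeR R)) :
  (forall i, measurable (A i)) ->
  lebesgue_rV R n [set x | forall i, A i (x ord0 i)] =
  (\prod_(i < n) @lebesgue_measure R (A i))%E.
Proof.
elim: n A => [|n ih] A mA.
  rewrite big_ord0 /= /dirac indicE mem_set//=; by case.
have mB : measurable [set x : 'rV[R]_n | forall i, A (lift ord0 i) (x ord0 i)].
  rewrite (_ : [set x | _] = \bigcap_(i in [set: 'I_n]) 
      ((fun x : 'rV[R]_n => x ord0 i : measurableTypeR R) @^-1` A (lift ord0 i))).
    apply: fin_bigcap_measurable => // i _.
    by have := measurable_rV_coor i measurableT (mA (lift ord0 i)); rewrite setTI.
  by apply/seteqP; split=> x /= h i; [move=> _; exact: h|exact: h].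
rewrite big_ord_recl -ih//= /lebesgue_rV_cons /pushforward.
rewrite -[RHS]product_measure1E//.
congr (_ _); apply/seteqP; split => -[a x] /=.
  move=> h; split.
    have := h ord0; rewrite (_ : rV_cons _ _ _ = a)//.
    have -> : (ord0 : 'I_n.+1) = lshift n (ord0 : 'I_1) by exact/val_inj.
    by apply: etrans (row_mxEl _ _ _ _) _; rewrite mxE.
  move=> i; have := h (lift ord0 i); rewrite (_ : rV_cons _ _ _ = x ord0 i)//.
  have -> : (lift ord0 i : 'I_n.+1) = @rshift 1 n i by exact/val_inj.
  exact: row_mxEr.
move=> [h1 h2] i; case: (unliftP ord0 i) => [j ->|->].
  rewrite (_ : rV_cons _ _ _ = x ord0 j)//.
  have -> : (lift ord0 j : 'I_n.+1) = @rshift 1 n j by exact/val_inj.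
  exact: row_mxEr.
rewrite (_ : rV_cons _ _ _ = a)//.
have -> : (ord0 : 'I_n.+1) = lshift n (ord0 : 'I_1) by exact/val_inj.
by apply: etrans (row_mxEl _ _ _ _) _; rewrite mxE.
Qed.

Section L2_operators.
Context d (T : measurableType d) (R : realType).
Variable mu : {measure set T -> \bar R}.

(* The real Hilbert space L^2(mu), whose elements are classes of functions
   modulo equality almost everywhere; they coerce to chosen representatives. *)
Local Notation L2 := (LspaceType2 mu).

Definition L2_inner (f g : L2) : R := \int[mu]_x ((f x : R) * g x).

Definition L2_cvg (u : nat -> L2) (f : L2) : Prop :=
  Lnorm mu 2%:E (fun x => ((u n x : R) - f x)%:E) @[n --> \oo] --> 0%E.

(* An unbounded operator is represented by its graph: (f, g) is in the graph
   of A iff f is in D(A) and g = A f. *)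
Definition L2_operator := set (L2 * L2).

(* u is in D(A^* ) and A^* u = w iff <A f, u> = <f, w> for all f in D(A). *)
Definition L2_adjoint (A : L2_operator) : L2_operator :=
  [set uw : L2 * L2 | forall f g, A (f, g) -> L2_inner g uw.1 = L2_inner f uw.2].

(* The closure of the graph, which is the graph of the closure of A when A is
   closable. *)
Definition L2_closure (A : L2_operator) : L2_operator :=
  [set fg : L2 * L2 | exists u w : nat -> L2,
    [/\ forall n, A (u n, w n), L2_cvg u fg.1 & L2_cvg w fg.2]].

Definition L2_opp (A : L2_operator) : L2_operator :=
  [set fg : L2 * L2 | exists2 h : L2, A (fg.1, h) &
    (fg.2 : T -> R) = (fun x => - (h x : R)) %[ae mu]].

Definition essentially_skew_adjoint (A : L2_operator) : Prop :=
  L2_adjoint A = L2_opp (L2_closure A).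

End L2_operators.

Section calculus_rV.
Variables (R : realType) (n : nat).
Local Notation leb := (lebesgue_rV R n).
Implicit Types (f : 'rV[R]_n -> R) (v : 'rV[R]_n -> 'rV[R]_n).

Definition partial (i : 'I_n) f : 'rV[R]_n -> R := 'D_(delta_mx ord0 i) f.

Definition grad f : 'rV[R]_n -> 'rV[R]_n :=
  fun x => \row_i partial i f x.

Definition dotv (x y : 'rV[R]_n) : R := \sum_i x ord0 i * y ord0 i.

(* All iterated partial derivatives exist and are continuous. *)
Definition smooth f : Prop := forall s : seq 'I_n,
  let g := foldr partial f s in
  continuous g /\ forall i x, derivable g x (delta_mx ord0 i).

Definition compactly_supported (V : zmodType) (f : 'rV[R]_n -> V) : Prop :=
  compact (closure [set x | f x != 0]).

Definition test_function f : Prop := smooth f /\ compactly_supported f.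

Definition Linfty_field v : Prop :=
  forall i, (fun x => v x ord0 i) \in Lfun leb +oo%E.

(* The distribution div v evaluated at phi. *)
Definition distr_div v (phi : 'rV[R]_n -> R) : R :=
  - \int[leb]_x dotv (v x) (grad phi x).

Definition div_free v : Prop :=
  forall phi, test_function phi -> distr_div v phi = 0.

(* The operator rho |-> v . grad rho on L^2 with domain the classes of the
   test functions rho. *)
Definition transport_operator v : L2_operator leb :=
  [set fg : LspaceType2 leb * LspaceType2 leb | exists rho, [/\ test_function rho,
    (fg.1 : 'rV[R]_n -> R) = rho %[ae leb] &
    (fg.2 : 'rV[R]_n -> R) = (fun x => dotv (v x) (grad rho x))
      %[ae leb]]].

End calculus_rV.

(* Main.v *)
(* Let C1, C2 be fat Cantor sets on the half line and let F x and G y be the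
   lengths of [0, x] and [0, y] outside C1 and C2. The rotated gradient v of the
   stream function H = F |x| + G |y|, cut off outside H < 1, is bounded,
   divergence-free, and vanishes on the Cantor dust K = {|x| in C1, |y| in C2},
   which has positive area. The values of F on C1 and of G on C2 are the sums of
   the base-4 digits 2 d_k and e_k with d_k, e_k in {0, 1}. Hence almost every
   level line of H meets K once in each quadrant, and the level of H maps the
   area on K in a quadrant to Lebesgue measure on ]0, 1[. If u is the indicator
   function of the part of the level lines in the first quadrant between the
   y-axis and K, made even in x and in y, then the flow of u starts and stops on
   K only: div (u v) = - w, where w is 1 or - 1 on K, depending on the quadrant,
   and 0 elsewhere. In dimension d one multiplies everything by the indicator
   function of the unit cube in the other variables. Thus A^* u = w, and also
   A^* w = 0 because v w = 0. If A were essentially skew-adjoint, there would be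
   test functions f with f -> w and A f -> 0, whence
   <w, w> = lim <f, w> = lim <A f, u> = 0. *)

From HB Require Import structures.
Require Import Defs.
From mathcomp Require Import all_boot all_order all_algebra.
From mathcomp Require Import all_classical all_reals all_analysis.
From mathcomp Require Import measurable_realfun ess_sup_inf.
From mathcomp Require Import ring lra.

Set Implicit Arguments.
Unset Strict Implicit.
Unset Printing Implicit Defensive.

Import Order.TTheory GRing.Theory Num.Theory.
Import numFieldNormedType.Exports.

Local Open Scope classical_set_scope.
Local Open Scope ring_scope.

(** * Bounded measurable functions supported in a set of finite measure *)

(** The base 4 comes from area. A pair of cells of generation n, one of each Cantor set, contains a
    part of the dust of area 4^-n, so the levels assigned to it have to fill an interval of length
    4^-n. Two binary trees give four pairs of children, and 2 d + e with d, e in {0, 1} takes each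
    of the values 0, 1, 2, 3 once; this is why the gap parameters [lam] of the two sets are 2 and 1.
    The set where u = 1 ends on the dust and has no regular boundary there, so div (u v) is not read
    off from boundary terms at once. The set is exhausted by finite unions of strips between two
    level lines, cut off by vertical lines just before the dust. For a strip, the fundamental
    theorem of calculus along the coordinate lines and the substitutions t = F x and t = G y leave
    an integral over the vertical cut alone. It is close to 4^-n times the value of the test
    function at the lower left corner of the pair of cells, and these values form a Riemann sum for
    the integral over the dust. *)

Section bounded_finite_support.
Context d (T : measurableType d) (R : realType).
Variable mu : {measure set T -> \bar R}.
Implicit Types f g : T -> R.

(** A class closed under sums, bounded multipliers, reflections and dominated limits, in which
    integrability follows from a pointwise bound alone. *)
Definition bfs f : Prop := measurable_fun [set: T] f /\
  exists (D : set T) (M : R),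
    [/\ measurable D, (mu D < +oo)%E & forall x, `|f x| <= M * \1_D x].

Lemma bfs_integrable f : bfs f -> mu.-integrable [set: T] (EFin \o f).
Proof.
move=> [mf [D [M [mD Dfin fM]]]].
have f0 x : ~ D x -> f x = 0.
  move=> nDx; apply/eqP; rewrite -normr_le0 (le_trans (fM x))//.
  by rewrite indicE memNset// mulr0.
apply: (eq_integrable _ (fun x => (f \_ D x)%:E)) => //.
  move=> x _ /=; rewrite patchE; case: ifPn => // xD; congr EFin.
  by rewrite f0// => Dx; move: xD; rewrite mem_set.
have -> : (fun x => (f \_ D x)%:E) = (EFin \o f) \_ D.
  by rewrite restrict_EFin.
rewrite -integrable_mkcond//; apply: measurable_bounded_integrable => //.
  exact: measurable_funTS.
exists M; split; first exact: num_real.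
move=> N MN x Dx /=; rewrite (le_trans (fM x))//.
by rewrite indicE mem_set// mulr1 ltW.
Qed.

Lemma bfs_le f g : measurable_fun [set: T] g ->
  (exists M, forall x, `|g x| <= M * `|f x|) -> bfs f -> bfs g.
Proof.
move=> mg [M gM] [mf [D [N [mD Dfin fN]]]]; split => //.
exists D, (`|M| * N); split => // x; rewrite (le_trans (gM x))// -mulrA.
rewrite (le_trans (ler_wpM2r _ (ler_norm M)))//.
by rewrite ler_wpM2l.
Qed.

Lemma bfsD f g : bfs f -> bfs g -> bfs (fun x => f x + g x).
Proof.
move=> [mf [D [M [mD Dfin fM]]]] [mg [E [N [mE Efin gN]]]]; split.
  exact: measurable_funD.
exists (D `|` E), (`|M| + `|N|); split; first exact: measurableU.
  by apply: (le_lt_trans (measureU2 _ mD mE)); rewrite lte_add_pinfty.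
move=> x; rewrite mulrDl (le_trans (ler_normD _ _))// lerD//.
  rewrite (le_trans (fM x))// (le_trans (ler_norm _))// normrM ler_wpM2l//.
  rewrite ger0_norm// !indicE; case: (boolP (x \in D)) => //.
  by rewrite inE => Dx; rewrite mem_set//; left.
rewrite (le_trans (gN x))// (le_trans (ler_norm _))// normrM ler_wpM2l//.
rewrite ger0_norm// !indicE; case: (boolP (x \in E)) => //.
by rewrite inE => Dx; rewrite mem_set//; right.
Qed.

Lemma bfsMl f g : measurable_fun [set: T] g -> (exists M, forall x, `|g x| <= M) ->
  bfs f -> bfs (fun x => g x * f x).
Proof.
move=> mg [M gM] bf; apply: (bfs_le _ _ bf).
  by apply: measurable_funM => //; case: bf.
by exists M => x; rewrite normrM ler_wpM2r.
Qed.

Lemma bfsZ (c : R) f : bfs f -> bfs (fun x => c * f x).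
Proof. by apply: bfsMl => //; exists `|c|. Qed.

Lemma bfsN f : bfs f -> bfs (fun x => - f x).
Proof.
move=> bf; have := bfsZ (- 1) bf.
by under eq_fun do rewrite mulN1r.
Qed.

Lemma bfsB f g : bfs f -> bfs g -> bfs (fun x => f x - g x).
Proof. by move=> bf /bfsN; exact: bfsD. Qed.

Lemma bfs_sum (I : Type) (r : seq I) (F : I -> T -> R) :
  (forall i, bfs (F i)) -> bfs (fun x => \sum_(i <- r) F i x).
Proof.
move=> bF; elim: r => [|i r ih].
  under eq_fun do rewrite big_nil.
  split; first exact: measurable_cst.
  by exists set0, 0; split; rewrite ?measure0 // => x; rewrite normr0 mul0r.
by under eq_fun do rewrite big_cons; exact: bfsD.
Qed.

Lemma bfs_indic (D : set T) (mD : measurable D) : (mu D < +oo)%E -> bfs \1_D.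
Proof.
move=> Dfin; split; first exact: measurable_indic.
by exists D, 1; split => // x; rewrite mul1r ger0_norm.
Qed.

Lemma bfs_RintegralD f g : bfs f -> bfs g ->
  \int[mu]_x (f x + g x) = \int[mu]_x f x + \int[mu]_x g x.
Proof. by move=> bf bg; rewrite RintegralD//; exact: bfs_integrable. Qed.

Lemma bfs_RintegralB f g : bfs f -> bfs g ->
  \int[mu]_x (f x - g x) = \int[mu]_x f x - \int[mu]_x g x.
Proof. by move=> bf bg; rewrite RintegralB//; exact: bfs_integrable. Qed.

Lemma bfs_RintegralZ c f : bfs f -> \int[mu]_x (c * f x) = c * \int[mu]_x f x.
Proof. by move=> bf; rewrite RintegralZl//; exact: bfs_integrable. Qed.

Lemma bfs_Rintegral_sum (I : Type) (r : seq I) (F : I -> T -> R) :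
  (forall i, bfs (F i)) ->
  \int[mu]_x (\sum_(i <- r) F i x) = \sum_(i <- r) \int[mu]_x F i x.
Proof.
move=> bF; elim: r => [|i r ih].
  by under eq_Rintegral do rewrite big_nil; rewrite big_nil Rintegral_cst// mul0r.
under eq_Rintegral do rewrite big_cons.
by rewrite bfs_RintegralD ?ih ?big_cons//; exact: bfs_sum.
Qed.

Lemma Rintegral0 : \int[mu]_x (0 : R) = 0.
Proof. by rewrite Rintegral_cst// mul0r. Qed.

Lemma Rintegral_eq0 f : (forall x, f x = 0) -> \int[mu]_x f x = 0.
Proof. by move=> f0; rewrite -Rintegral0; apply: eq_Rintegral => x _. Qed.

Lemma bfs_le_Rintegral f g : bfs f -> bfs g -> (forall x, f x <= g x) ->
  \int[mu]_x f x <= \int[mu]_x g x.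
Proof. by move=> bf bg fg; apply: le_Rintegral => //; exact: bfs_integrable. Qed.

Lemma bfs_normr_Rintegral f g : bfs f -> bfs g -> (forall x, `|f x| <= g x) ->
  `|\int[mu]_x f x| <= \int[mu]_x g x.
Proof.
move=> bf bg fg; rewrite (le_trans (le_normr_Rintegral _ (bfs_integrable bf)))//.
apply: bfs_le_Rintegral => //; apply: (bfs_le _ _ bf).
  by apply: measurableT_comp => //; case: bf.
by exists 1 => x; rewrite mul1r normr_id.
Qed.

Lemma Rintegral_indic (D : set T) : measurable D ->
  \int[mu]_x (\1_D x : R) = fine (mu D).
Proof. by move=> mD; rewrite /Rintegral integral_indic// setIT. Qed.

Lemma bfs_cvg (f_ : nat -> T -> R) f g : (forall n, measurable_fun [set: T] (f_ n)) ->
  (forall x, f_ n x @[n --> \oo] --> f x) -> bfs g ->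
  (forall n x, `|f_ n x| <= g x) ->
  bfs f /\ \int[mu]_x f_ n x @[n --> \oo] --> \int[mu]_x f x.
Proof.
move=> mf cf bg fg.
have mlim : measurable_fun [set: T] f.
  by apply: (measurable_fun_cvg mf) => x _; exact: cf.
have fg' x : `|f x| <= g x.
  have cn : `|f_ n x| @[n --> \oo] --> `|f x| by apply: cvg_norm; exact: cf.
  by rewrite -(cvg_lim _ cn)//; apply: limr_le => //; [exact: (cvgP _ cn)|exact: nearW].
split.
  apply: (bfs_le mlim _ bg); exists 1 => x; rewrite mul1r (le_trans (fg' x))//.
  exact: ler_norm.
have [] := @dominated_convergence _ T R mu [set: T] measurableT
  (fun n => EFin \o f_ n) (EFin \o f) (EFin \o g).
- by move=> n; exact/measurable_EFinP.
- exact/measurable_EFinP.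
- by apply: aeW => x _; apply: cvg_EFin; [exact: nearW|exact: cf].
- exact: bfs_integrable.
- by apply: aeW => x n _ /=; rewrite lee_fin.
move=> /= intf _; rewrite -(fineK (integrable_fin_num measurableT intf)).
by move=> /fine_cvgP[].
Qed.

End bounded_finite_support.

(** * Fubini's theorem for bounded functions supported in a product of sets of finite measure *)

Section bounded_finite_support_product.
Context d1 d2 (T1 : measurableType d1) (T2 : measurableType d2) (R : realType).
Variables (m1 : {sigma_finite_measure set T1 -> \bar R}).
Variables (m2 : {sigma_finite_measure set T2 -> \bar R}).
Implicit Types f g : T1 * T2 -> R.

(** The support is enclosed in a product of sets of finite measure, not just in a set of finite
    product measure, so that every slice, and not merely almost every one, is in [bfs]. *)
Definition bfs2 f : Prop := measurable_fun [set: T1 * T2] f /\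
  exists (D1 : set T1) (D2 : set T2) (M : R),
    [/\ measurable D1 /\ (m1 D1 < +oo)%E, measurable D2 /\ (m2 D2 < +oo)%E
      & forall x, `|f x| <= M * (\1_D1 x.1 * \1_D2 x.2)].

Lemma bfs2_bfs f : bfs2 f -> bfs (m1 \x m2)%E f.
Proof.
move=> [mf [D1 [D2 [M [[mD1 D1fin] [mD2 D2fin] fM]]]]]; split => //.
exists (D1 `*` D2), M; split => //.
- exact: measurableX.
- apply: (@le_lt_trans _ _ (m1 D1 * m2 D2)%E).
    by rewrite /= product_measure1E.
  by rewrite lte_mul_pinfty// ge0_fin_numE.
- move=> x; rewrite (le_trans (fM x))// !indicE in_setX.
  by rewrite -natrM mulnb.
Qed.

Lemma bfs2_slice1 f y : bfs2 f -> bfs m1 (fun x => f (x, y)).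
Proof.
move=> [mf [D1 [D2 [M [[mD1 D1fin] [mD2 D2fin] fM]]]]]; split.
  exact: measurable_fun_pair1.
exists D1, `|M|; split => // x; rewrite (le_trans (fM _))//=.
rewrite (le_trans (ler_norm _))// normrM ler_wpM2l// ger0_norm ?mulr_ge0//.
by rewrite ler_piMr// indicE lern1 leq_b1.
Qed.

Lemma bfs2_slice2 f x : bfs2 f -> bfs m2 (fun y => f (x, y)).
Proof.
move=> [mf [D1 [D2 [M [[mD1 D1fin] [mD2 D2fin] fM]]]]]; split.
  exact: measurable_fun_pair2.
exists D2, `|M|; split => // y; rewrite (le_trans (fM _))//=.
rewrite (le_trans (ler_norm _))// normrM ler_wpM2l// ger0_norm ?mulr_ge0//.
by rewrite ler_piMl// indicE lern1 leq_b1.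
Qed.

Lemma bfs2_int1 f : bfs2 f -> bfs m2 (fun y => \int[m1]_x f (x, y)).
Proof.
move=> bf; have bf2 := bfs2_bfs bf; have := bf.
move=> [mf [D1 [D2 [M [[mD1 D1fin] [mD2 D2fin] fM]]]]]; split.
  have /measurable_EFinP/= mEf := mf.
  have := measurable_fubini_G (bfs_integrable bf2).
  by move=> /(measurableT_comp (fine_measurable measurableT)); exact.
exists D2, (`|M| * fine (m1 D1)); split => // y.
have bD1 := bfsZ (M * \1_D2 y) (bfs_indic mD1 D1fin).
rewrite (le_trans (bfs_normr_Rintegral (bfs2_slice1 y bf) bD1 _))//.
  by move=> x; rewrite (le_trans (fM _))//= mulrAC mulrA.
rewrite bfs_RintegralZ ?Rintegral_indic//; last exact: bfs_indic.
rewrite mulrAC ler_wpM2r// ler_wpM2r ?ler_norm//.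
Qed.

Lemma bfs2_Fubini1 f : bfs2 f ->
  \int[(m1 \x m2)%E]_z f z = \int[m2]_y \int[m1]_x f (x, y).
Proof.
move=> bf; rewrite {1}/Rintegral -integral21_prod_meas1//; last first.
  exact: bfs_integrable (bfs2_bfs bf).
congr fine; apply: eq_integral => y _; rewrite /fubini_G fineK//.
apply: integrable_fin_num => //; exact: (bfs_integrable (bfs2_slice1 y bf)).
Qed.

Lemma bfs2_Fubini2 f : bfs2 f ->
  \int[(m1 \x m2)%E]_z f z = \int[m1]_x \int[m2]_y f (x, y).
Proof.
move=> bf; rewrite {1}/Rintegral -integral12_prod_meas1//; last first.
  exact: bfs_integrable (bfs2_bfs bf).
congr fine; apply: eq_integral => x _; rewrite /fubini_F fineK//.
apply: integrable_fin_num => //; exact: (bfs_integrable (bfs2_slice2 x bf)).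
Qed.

Lemma bfs2_le f g : measurable_fun [set: T1 * T2] g ->
  (exists M, forall x, `|g x| <= M * `|f x|) -> bfs2 f -> bfs2 g.
Proof.
move=> mg [M gM] [mf [D1 [D2 [N [mD1 mD2 fN]]]]]; split => //.
exists D1, D2, (`|M| * N); split => // x; rewrite (le_trans (gM x))// -mulrA.
by rewrite (le_trans (ler_wpM2r _ (ler_norm M)))// ler_wpM2l.
Qed.

Lemma bfs2D f g : bfs2 f -> bfs2 g -> bfs2 (fun x => f x + g x).
Proof.
move=> [mf [D1 [D2 [M [[mD1 D1f] [mD2 D2f] fM]]]]].
move=> [mg [E1 [E2 [N [[mE1 E1f] [mE2 E2f] gN]]]]]; split.
  exact: measurable_funD.
exists (D1 `|` E1), (D2 `|` E2), (`|M| + `|N|); split.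
- split; first exact: measurableU.
  by apply: (le_lt_trans (measureU2 _ mD1 mE1)); rewrite lte_add_pinfty.
- split; first exact: measurableU.
  by apply: (le_lt_trans (measureU2 _ mD2 mE2)); rewrite lte_add_pinfty.
- have indU T (A B : set T) x : \1_A x <= \1_(A `|` B) x :> R.
    rewrite !indicE in_setU; case: (x \in A) => //=.
  have indU' T (A B : set T) x : \1_A x <= \1_(B `|` A) x :> R.
    by rewrite setUC; exact: indU.
  move=> x; rewrite mulrDl (le_trans (ler_normD _ _))// lerD//.
    rewrite (le_trans (fM x))// (le_trans (ler_norm _))// normrM ler_wpM2l//.
    by rewrite ger0_norm ?mulr_ge0// ler_pM.
  rewrite (le_trans (gN x))// (le_trans (ler_norm _))// normrM ler_wpM2l//.
  by rewrite ger0_norm ?mulr_ge0// ler_pM.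
Qed.

Lemma bfs2Ml f g : measurable_fun [set: T1 * T2] g ->
  (exists M, forall x, `|g x| <= M) -> bfs2 f -> bfs2 (fun x => g x * f x).
Proof.
move=> mg [M gM] bf; apply: (bfs2_le _ _ bf).
  by apply: measurable_funM => //; case: bf.
by exists M => x; rewrite normrM ler_wpM2r.
Qed.

Lemma bfs2_prod (f : T1 -> R) (g : T2 -> R) : bfs m1 f -> bfs m2 g ->
  bfs2 (fun x => f x.1 * g x.2).
Proof.
move=> [mf [D [M [mD Dfin fM]]]] [mg [E [N [mE Efin gN]]]]; split.
  by apply: measurable_funM; exact: measurableT_comp.
exists D, E, (M * N); split => // x; rewrite normrM mulrACA.
by rewrite ler_pM.
Qed.

End bounded_finite_support_product.

(** * Changes of variables on the real line *)

Section lebesgue_transport.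
Variable R : realType.
Notation leb := (@lebesgue_measure R).
Notation RT := (measurableTypeR R).
Variables (C : set RT) (Q : RT -> RT).
Hypotheses (mC : measurable C) (Cfin : (leb C < +oo)%E).
Hypothesis mQ : measurable_fun [set: RT] Q.
Hypothesis QC : forall a b, a < b ->
  (leb (Q @^-1` `]a, b]) + leb (`]a, b] `&` C) = (b - a)%:E)%E.

Let nu := measure_function_pushforward__canonical__measure_function_Measure leb mQ.

(** On half-open intervals this is [QC]; as these generate the Borel sets, uniqueness of Lebesgue
    measure extends it to all of them. *)
Let leb_add A : measurable A -> leb A = measure_add nu (mrestr leb mC) A.
Proof.
move=> mA.
apply: (@lebesgue_measure_unique R (measure_add nu (mrestr leb mC))) => //.
move=> X [[a b] _ <-].
apply: (@eq_trans _ _ (leb (Q @^-1` `]a, b]) + leb (`]a, b] `&` C))%E); last first.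
  by symmetry; exact: (measure_addE nu (mrestr leb mC)).
rewrite [LHS]lebesgue_measure_itv/= lte_fin; case: ifPn => ab.
  by rewrite -EFinB -QC.
rewrite set_itv_ge ?bnd_simp -?leNgt ?leNgt//.
by rewrite preimage_set0 set0I measure0 adde0.
Qed.

Lemma lebesgue_transport_measure A : measurable A ->
  leb (Q @^-1` A) = leb (A `\` C).
Proof.
move=> mA; have ACfin : leb (A `&` C) \is a fin_num.
  rewrite ge0_fin_numE// (le_lt_trans _ Cfin)// le_measure// inE//.
  exact: measurableI.
have : leb A = (leb (Q @^-1` A) + leb (A `&` C))%E.
  by rewrite leb_add//; exact: (measure_addE nu (mrestr leb mC)).
rewrite (measureDI leb mA mC) => /(congr1 (fun x => x - leb (A `&` C))%E).
by rewrite !addeK.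
Qed.

Lemma bfs_transport (g : RT -> R) : bfs leb g -> bfs leb (g \o Q).
Proof.
move=> [mg [D [M [mD Dfin gM]]]]; split; first exact: measurableT_comp.
exists (Q @^-1` D), M; split.
- by rewrite -[X in measurable X]setTI; exact: mQ.
- rewrite /= lebesgue_transport_measure// (le_lt_trans _ Dfin)// le_measure// inE//.
  exact: measurableD.
- by move=> x; rewrite (le_trans (gM _)).
Qed.

(** The push-forward of Lebesgue measure under [Q] is Lebesgue measure outside [C]. In particular
    the preimage of [C] is null, so the integral on the left may be restricted to the preimage of
    the complement. *)
Lemma lebesgue_transport (g : RT -> R) : bfs leb g ->
  \int[leb]_x g (Q x) = \int[leb]_x (\1_(~` C) x * g x).
Proof.
move=> bg; have mg : measurable_fun [set: RT] g by case: bg.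
have mEg : measurable_fun [set: RT] (EFin \o g) by exact/measurable_EFinP.
have mnC : measurable (~` C) by exact: measurableC.
have mQC : measurable (Q @^-1` C) by rewrite -[X in measurable X]setTI; exact: mQ.
have igQ := bfs_integrable (bfs_transport bg).
have igQ' : leb.-integrable (Q @^-1` (~` C)) ((EFin \o g) \o Q).
  by apply: (integrableS measurableT _ _ igQ) => //; exact: measurableC.
have rnC : mrestr leb mC (~` C) = 0%E by rewrite /mrestr setICl measure0.
transitivity (\int[leb]_(x in ~` C) g x); last first.
  rewrite Rintegral_mkcond; apply: eq_Rintegral => x _.
  by rewrite patchE indicE; case: ifPn => _; rewrite ?mul1r ?mul0r.
congr fine; rewrite [RHS](eq_measure_integral (measure_add nu (mrestr leb mC))); last first.
  by move=> A mA _; exact: leb_add.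
rewrite integral_measure_add//=; last 2 first.
- exact: (integrable_pushforward mQ mEg igQ' mnC).
- by apply: null_set_integrable => //; exact: measurable_funTS.
rewrite [X in _ = (_ + X)%E]null_set_integral ?adde0//; last exact: measurable_funTS.
rewrite (integral_pushforward mQ mEg igQ' mnC) preimage_setC -setTD.
rewrite -negligible_integral//; first exact: measurableT.
by rewrite -(measure0 leb) -(setDv C); exact: lebesgue_transport_measure.
Qed.

End lebesgue_transport.

Section lebesgue_reflection.
Variable R : realType.
Notation leb := (@lebesgue_measure R).
Notation RT := (measurableTypeR R).
Variable h : R.

Let mrefl : measurable_fun [set: RT] (fun x => h - x : RT).
Proof. exact: measurable_funB. Qed.

Let reflE (a b : R) : a < b ->
  (leb ((fun x : RT => (h - x)%R : RT) @^-1` `]a, b]) + leb (`]a, b] `&` set0) = (b - a)%:E)%E.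
Proof.
move=> ab; rewrite setI0 measure0 adde0.
rewrite (_ : _ @^-1` _ = `[h - b, h - a[%classic); last first.
  by apply/seteqP; split=> x /=; rewrite !in_itv/= => /andP[? ?]; apply/andP; split; lra.
rewrite lebesgue_measure_itv/= lte_fin ltrD2l ltrN2 ab -EFinB; congr EFin; lra.
Qed.

Lemma bfs_reflection (g : RT -> R) : bfs leb g -> bfs leb (fun x => g (h - x)).
Proof. by apply: (bfs_transport (C := set0)) => //; rewrite measure0. Qed.

Lemma lebesgue_reflection (g : RT -> R) : bfs leb g ->
  \int[leb]_x g (h - x) = \int[leb]_x g x.
Proof.
move=> bg; rewrite (lebesgue_transport (C := set0) _ _ mrefl reflE)//; last by rewrite measure0.
by apply: eq_Rintegral => x _; rewrite setC0 indicT mul1r.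
Qed.

End lebesgue_reflection.

(** * The length outside a set and its lower adjoint *)

Section gap_length.
Variable R : realType.
Notation leb := (@lebesgue_measure R).
Notation RT := (measurableTypeR R).
Variable C : set RT.

Definition mass_upto (x : R) : R := fine (leb (`]-oo, x] `&` C)).

(** For [C] in the half line this is the length of [0, x] outside [C] if x >= 0, and x itself if x
    <= 0; thus it maps the real line onto itself and [gap_inv] is defined everywhere. *)
Definition gap_length (x : R) : R := x - mass_upto x.

(* The least solution of [gap_length x = t]; it is the lower adjoint of
   [gap_length] (lemma [gap_inv_leE]), which is all that is needed of it, so
   that [gap_length] need not be injective. *)
Definition gap_inv (t : R) : R := inf [set x | t <= gap_length x].

Hypotheses (mC : measurable C) (C_ge0 : forall x : R, C x -> 0 <= x)
  (C_le1 : (leb C <= 1)%E).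

Let IC_fin (A : set RT) : measurable A -> leb (A `&` C) \is a fin_num.
Proof.
move=> mA; rewrite ge0_fin_numE//.
apply: (@le_lt_trans _ _ (leb C)); last exact: le_lt_trans C_le1 (ltry _).
by rewrite le_measure// inE//; exact: measurableI.
Qed.

Lemma gap_mass_fin : (leb C < +oo)%E.
Proof. exact: le_lt_trans C_le1 (ltry _). Qed.

Lemma mass_upto_itv (x y : R) : x <= y ->
  leb (`]x, y] `&` C) = (mass_upto y - mass_upto x)%:E.
Proof.
move=> xy; have E : `]-oo, y] `&` C = (`]-oo, x] `&` C) `|` (`]x, y] `&` C).
  rewrite -setIUl; congr (_ `&` _); apply/seteqP; split=> z /=; rewrite !in_itv/=.
    by move=> zy; case: (leP z x) => zx; [left|right].
  by move=> [zx|/andP[]//]; rewrite (le_trans zx).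
have : leb (`]-oo, y] `&` C) = (leb (`]-oo, x] `&` C) + leb (`]x, y] `&` C))%E.
  rewrite E measureU//; [exact: measurableI|exact: measurableI|].
  apply/seteqP; split => // z /= [[+ _] [+ _]]; rewrite !in_itv/=.
  by move=> zx /andP[xz _]; move: (le_lt_trans zx xz); rewrite ltxx.
by move=> H; rewrite /mass_upto H fineD ?IC_fin// addrC addKr fineK ?IC_fin.
Qed.

Lemma mass_upto_nd (x y : R) : x <= y -> 0 <= mass_upto y - mass_upto x.
Proof. by move=> xy; rewrite -lee_fin -mass_upto_itv// measure_ge0. Qed.

Lemma mass_upto_le (x y : R) : x <= y -> mass_upto y - mass_upto x <= y - x.
Proof.
move=> xy; rewrite -lee_fin -mass_upto_itv//.
apply: (@le_trans _ _ (leb `]x, y])).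
  by rewrite le_measure// inE//; exact: measurableI.
by rewrite lebesgue_measure_itv/=; case: ifPn => // _; rewrite lee_fin subr_ge0.
Qed.

Lemma mass_upto_ge0 (x : R) : 0 <= mass_upto x.
Proof. by rewrite fine_ge0. Qed.

Lemma mass_upto_le1 (x : R) : mass_upto x <= 1.
Proof.
rewrite -lee_fin fineK ?IC_fin// (le_trans _ C_le1)// le_measure// inE//.
exact: measurableI.
Qed.

Lemma mass_upto0 (x : R) : x <= 0 -> mass_upto x = 0.
Proof.
move=> x0; apply: (@eq_trans _ _ (fine (leb set0))); last by rewrite measure0.
congr fine; apply/eqP; rewrite measure0 eq_le measure_ge0 andbT.
rewrite -(lebesgue_measure_set1 (0 : R)) le_measure// ?inE//; first exact: measurableI.
move=> z [] /=; rewrite in_itv/= => zx /C_ge0 z0; apply/eqP.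
by rewrite eq_le z0 (le_trans zx).
Qed.

Lemma gap_length_nd (x y : R) : x <= y -> gap_length x <= gap_length y.
Proof. by move=> xy; rewrite /gap_length; have := mass_upto_le xy; lra. Qed.

Lemma gap_length_lip (x y : R) : x <= y -> gap_length y - gap_length x <= y - x.
Proof. by move=> xy; rewrite /gap_length; have := mass_upto_nd xy; lra. Qed.

Lemma gap_length_le0 (x : R) : x <= 0 -> gap_length x = x.
Proof. by move=> x0; rewrite /gap_length mass_upto0// subr0. Qed.

Lemma gap_length_ge0 (x : R) : 0 <= x -> 0 <= gap_length x.
Proof. by move=> /gap_length_nd; rewrite gap_length_le0. Qed.

Lemma gap_length_ge (x : R) : x - 1 <= gap_length x.
Proof. by rewrite lerD2l lerN2 mass_upto_le1. Qed.

Lemma gap_length_le (x : R) : gap_length x <= x.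
Proof. by rewrite /gap_length; have := mass_upto_ge0 x; lra. Qed.

Let gap_set_has_inf t : has_inf [set x | t <= gap_length x].
Proof.
split; first by exists (t + 1) => /=; have := gap_length_ge (t + 1); lra.
by exists t => x /= /le_trans; apply; exact: gap_length_le.
Qed.

(** The infimum is attained: by the Lipschitz bound, [gap_length] at the infimum is less than e
    below its value at some point of the set, for every e. *)
Lemma gap_inv_ge (t : R) : t <= gap_length (gap_inv t).
Proof.
apply/ler_addgt0Pr => e e0.
have [x /= tx xe] := inf_adherent e0 (gap_set_has_inf t).
have xi : gap_inv t <= x by apply: ge_inf => //; case: (gap_set_has_inf t).
have := gap_length_lip xi; rewrite -/(gap_inv t) in xe *; lra.
Qed.

Lemma gap_inv_leE (t x : R) : (gap_inv t <= x) = (t <= gap_length x).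
Proof.
apply/idP/idP => [tx|tx]; last first.
  by apply: ge_inf => //; case: (gap_set_has_inf t).
exact: le_trans (gap_inv_ge t) (gap_length_nd tx).
Qed.

Lemma gap_inv_ltE (t x : R) : (x < gap_inv t) = (gap_length x < t).
Proof. by rewrite !ltNge gap_inv_leE. Qed.

(** Immediately to the left of [gap_inv t] the values of [gap_length] are below [t], and the
    Lipschitz bound carries this over to the point itself. *)
Lemma gap_lengthK (t : R) : gap_length (gap_inv t) = t.
Proof.
apply/eqP; rewrite eq_le gap_inv_ge andbT; apply/ler_addgt0Pr => e e0.
have : gap_inv t - e < gap_inv t by lra.
rewrite gap_inv_ltE => h.
have /gap_length_lip : gap_inv t - e <= gap_inv t by lra.
lra.
Qed.

Lemma gap_inv_nd (s t : R) : s <= t -> gap_inv s <= gap_inv t.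
Proof. by move=> st; rewrite gap_inv_leE gap_lengthK. Qed.

Lemma gap_inv_gt0 (t : R) : (0 < gap_inv t) = (0 < t).
Proof. by rewrite gap_inv_ltE gap_length_le0. Qed.

Lemma measurable_gap_inv : measurable_fun [set: RT] (gap_inv : RT -> RT).
Proof.
by apply: nondecreasing_measurable => // s t /gap_inv_nd.
Qed.

Lemma measurable_gap_length : measurable_fun [set: RT] (gap_length : RT -> RT).
Proof.
by apply: nondecreasing_measurable => // s t /gap_length_nd.
Qed.

(** By adjunction the preimage of ]a, b] is the interval from [gap_length a] to [gap_length b],
    whose length is b - a less the mass of [C] in ]a, b]. *)
Lemma gap_transport_itv a b : a < b ->
  (leb (gap_inv @^-1` `]a, b]) + leb (`]a, b] `&` C) = (b - a)%:E)%E.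
Proof.
move=> ab; rewrite mass_upto_itv ?ltW//.
rewrite (_ : _ @^-1` _ = `]gap_length a, gap_length b]%classic); last first.
  by apply/seteqP; split=> t /=; rewrite !in_itv/= gap_inv_leE gap_inv_ltE.
rewrite lebesgue_measure_itv/= lte_fin; have := gap_length_nd (ltW ab).
rewrite le_eqVlt => /predU1P[E|->]; last by rewrite -EFinB -EFinD /gap_length; congr EFin; lra.
by rewrite E ltxx add0e; congr EFin; move: E; rewrite /gap_length; lra.
Qed.

(** This is the substitution t = [gap_length] x, the indicator function of the complement of [C]
    being the derivative of [gap_length] almost everywhere. *)
Lemma gap_transport (g : RT -> R) : bfs leb g ->
  \int[leb]_x (\1_(~` C) x * g x) = \int[leb]_t g (gap_inv t).
Proof.
move=> bg; symmetry.
exact: (lebesgue_transport mC gap_mass_fin measurable_gap_inv gap_transport_itv).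
Qed.

End gap_length.

(** * A fat Cantor set *)

Lemma big_ord_pow2S (R : nmodType) n (f : nat -> R) :
  \sum_(i < 2 ^ n.+1) f i = \sum_(i < 2 ^ n) (f i.*2 + f i.*2.+1).
Proof.
rewrite expnS mul2n; elim: (2 ^ n)%N => [|m ih]; first by rewrite !big_ord0.
by rewrite doubleS !big_ord_recr/= ih addrA.
Qed.

(** Every index of generation n + 1 in the binary tree is the left or the right child of an index of
    generation n. *)
Lemma ltn_pow2S_ind n (P : nat -> Prop) :
  (forall j, (j < 2 ^ n)%N -> P j.*2 /\ P j.*2.+1) ->
  forall i, (i < 2 ^ n.+1)%N -> P i.
Proof.
move=> Pn i; rewrite expnS mul2n -ltn_half_double => /Pn[Pe Po].
by rewrite -[i]odd_double_half; case: (odd i).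
Qed.

Section fat_cantor.
Variable R : realType.
Notation leb := (@lebesgue_measure R).
Notation RT := (measurableTypeR R).
Variable lam : R.

(* If [i] has binary digits d_1 ... d_n, then [cell_left n i] is the sum of the
   d_k (2^-k + lam 4^-k), and [cell_gap n i] that of the lam d_k 4^-k. *)
Definition cell_length (n : nat) : R := 2^-1 ^+ n + lam * 4^-1 ^+ n.

Fixpoint cell_gap (n i : nat) : R :=
  if n is n'.+1 then
    cell_gap n' i./2 + (odd i)%:R * (lam * 4^-1 ^+ n)
  else 0.

Definition cell_left (n i : nat) : R := i%:R * 2^-1 ^+ n + cell_gap n i.

(** Both children are adjacent and start at the left end of the cell, so that the part removed, of
    length lam 4^-n / 2, lies at its right end. Half-open intervals make the adjacent children
    disjoint. *)
Definition cell (n i : nat) : set R :=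
  `]cell_left n i, cell_left n i + cell_length n]%classic.

Fixpoint cell_cover (m n i : nat) : set R :=
  if m is m'.+1 then
    cell_cover m' n.+1 i.*2 `|` cell_cover m' n.+1 i.*2.+1
  else cell n i.

Definition fat_cantor_cell (n i : nat) : set R := \bigcap_m cell_cover m n i.

Definition fat_cantor : set R := fat_cantor_cell 0 0.

Lemma cell_gap_even n i : cell_gap n.+1 i.*2 = cell_gap n i.
Proof. by rewrite /= doubleK odd_double mul0r addr0. Qed.

Lemma cell_gap_odd n i :
  cell_gap n.+1 i.*2.+1 = cell_gap n i + lam * 4^-1 ^+ n.+1.
Proof. by rewrite [LHS]/= uphalf_double odd_double/= mul1r. Qed.

Lemma cell_left_even n i : cell_left n.+1 i.*2 = cell_left n i.
Proof.
rewrite /cell_left cell_gap_even -muln2 natrM exprS.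
by rewrite -mulrA mulVKf.
Qed.

Lemma cell_left_odd n i :
  cell_left n.+1 i.*2.+1 = cell_left n i + cell_length n.+1.
Proof.
rewrite -[cell_left n i]cell_left_even /cell_left cell_gap_odd cell_gap_even /cell_length.
by rewrite -[in LHS]natr1; ring.
Qed.

Hypothesis lam_gt0 : 0 < lam.

Let hf_gt0 n : (0 : R) < 2^-1 ^+ n. Proof. by rewrite exprn_gt0. Qed.

Let qt_gt0 n : 0 < lam * 4^-1 ^+ n. Proof. by rewrite mulr_gt0// exprn_gt0. Qed.

Lemma cell_gap_ge0 n i : 0 <= cell_gap n i.
Proof.
elim: n i => [//|n ih] i /=.
by rewrite addr_ge0// mulr_ge0// ltW.
Qed.

Lemma cell_left_ge0 n i : 0 <= cell_left n i.
Proof. by rewrite addr_ge0 ?cell_gap_ge0// mulr_ge0// ltW. Qed.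

Lemma cell_length_gt0 n : 0 < cell_length n.
Proof. by rewrite addr_gt0. Qed.

Lemma cell_length_half n : cell_length n.+1 + cell_length n.+1 <= cell_length n.
Proof.
rewrite /cell_length !exprS; have := hf_gt0 n; have := qt_gt0 n.
move: (2^-1 ^+ n) (4^-1 ^+ n) => x y; nra.
Qed.

Lemma cell_even_sub n i : cell n.+1 i.*2 `<=` cell n i.
Proof.
move=> x; rewrite /cell cell_left_even /= !in_itv/= => /andP[-> /= xle].
rewrite (le_trans xle)// lerD2l.
have := cell_length_half n; have := cell_length_gt0 n.+1; lra.
Qed.

Lemma cell_odd_sub n i : cell n.+1 i.*2.+1 `<=` cell n i.
Proof.
move=> x; rewrite /cell cell_left_odd /= !in_itv/=.
have := cell_length_half n; have := cell_length_gt0 n.+1; move=> ? ? /andP[? ?].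
by apply/andP; split; lra.
Qed.

Lemma cell_disj n i x : cell n.+1 i.*2 x -> ~ cell n.+1 i.*2.+1 x.
Proof.
rewrite /cell cell_left_odd cell_left_even /= !in_itv/= => /andP[_ ?] /andP[? _].
lra.
Qed.

Lemma cell_cover_cell m n i : cell_cover m n i `<=` cell n i.
Proof.
elim: m n i => [|m ih] n i x //=.
by move=> [/ih|/ih]; [exact: cell_even_sub|exact: cell_odd_sub].
Qed.

Lemma cell_cover_dec m n i : cell_cover m.+1 n i `<=` cell_cover m n i.
Proof.
elim: m n i => [|m ih] n i.
  by move=> x [|]; [exact: cell_even_sub|exact: cell_odd_sub].
move=> x /= [|] h; [left|right]; exact: ih.
Qed.

Lemma measurable_cell n i : measurable (cell n i : set RT).
Proof. exact: measurable_itv. Qed.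

Lemma measurable_cell_cover m n i : measurable (cell_cover m n i : set RT).
Proof.
elim: m n i => [|m ih] n i /=; first exact: measurable_cell.
by apply: measurableU; exact: ih.
Qed.

Lemma measurable_fat_cantor_cell n i : measurable (fat_cantor_cell n i : set RT).
Proof. by apply: bigcap_measurable => // m _; exact: measurable_cell_cover. Qed.

(** After m subdivisions there are 2^m disjoint cells of length 2^-(n+m) + lam 4^-(n+m). *)
Lemma leb_cell_cover m n i :
  leb (cell_cover m n i) = (2^-1 ^+ n + lam * 4^-1 ^+ n * 2^-1 ^+ m)%:E.
Proof.
elim: m n i => [|m ih] n i.
  rewrite /= lebesgue_measure_itv/= lte_fin ltrDl cell_length_gt0 -EFinB.
  by rewrite addrAC subrr add0r expr0 mulr1.
rewrite /= measureU; [|exact: measurable_cell_cover|exact: measurable_cell_cover|].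
  by rewrite /= !ih -EFinD !exprS; congr EFin; field.
by apply/seteqP; split => // x [/cell_cover_cell h /cell_cover_cell]; exact: cell_disj.
Qed.

Lemma leb_fat_cantor_cell n i : leb (fat_cantor_cell n i) = (2^-1 ^+ n)%:E.
Proof.
have cn : leb \o (fun m => cell_cover m n i) @ \oo --> leb (fat_cantor_cell n i).
  apply: nonincreasing_cvg_mu => //.
  - by rewrite [X in (X < _)%E]leb_cell_cover ltry.
  - by move=> m; exact: measurable_cell_cover.
  - exact: measurable_fat_cantor_cell.
  - by apply/nonincreasing_seqP => m; apply/subsetPset; exact: cell_cover_dec.
rewrite -(cvg_lim _ cn)//; apply: cvg_lim => //.
rewrite [X in X @ _ --> _](_ : _ =
    (fun m => (2^-1 ^+ n + lam * 4^-1 ^+ n * 2^-1 ^+ m)%:E)); last first.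
  by apply/funext => m /=; rewrite leb_cell_cover.
apply: cvg_EFin; first exact: nearW.
rewrite -[X in _ --> X]addr0; apply: cvgD; first exact: cvg_cst.
rewrite -[X in _ --> X](mulr0 (lam * 4^-1 ^+ n)); apply: cvgMr.
by apply: cvg_expr; rewrite ger0_norm ?invr_ge0// invf_lt1// ltr1n.
Qed.

Lemma fat_cantor_cellE n i :
  fat_cantor_cell n i = fat_cantor_cell n.+1 i.*2 `|` fat_cantor_cell n.+1 i.*2.+1.
Proof.
apply/seteqP; split => x.
  (* The first subdivision decides in which child [x] lies; by disjointness the later ones agree
     with it. *)
  move=> Cx; have [Ex|Ox] := Cx 1%N I.
    left=> m _; have [//|/cell_cover_cell Ox] := Cx m.+1 I.
    by case: (cell_disj Ex Ox).
  right=> m _; have [/cell_cover_cell Ex|//] := Cx m.+1 I.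
  by case: (cell_disj Ex Ox).
by move=> [h|h] m _; apply: cell_cover_dec; [left|right]; exact: h.
Qed.

Lemma fat_cantor_cell_sub n i : fat_cantor_cell n i `<=` cell n i.
Proof. by move=> x /(_ 0%N I). Qed.

Lemma fat_cantorI_cell n i : (i < 2 ^ n)%N ->
  cell n i `&` fat_cantor = fat_cantor_cell n i.
Proof.
elim: n i => [i|n ih].
  rewrite expn0 ltnS leqn0 => /eqP ->; apply/setIidPr.
  exact: fat_cantor_cell_sub.
apply: ltn_pow2S_ind => {}i /ih {}ih; split.
- rewrite -(setIidl (@cell_even_sub n i)) -setIA ih fat_cantor_cellE.
  rewrite setIUr (setIidr (@fat_cantor_cell_sub _ _)) setUidl//.
  by move=> x [h /fat_cantor_cell_sub h']; case: (cell_disj h h').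
- rewrite -(setIidl (@cell_odd_sub n i)) -setIA ih fat_cantor_cellE.
  rewrite setIUr [X in _ `|` X](setIidr (@fat_cantor_cell_sub _ _)) setUidr//.
  by move=> x [h /fat_cantor_cell_sub h']; case: (cell_disj h' h).
Qed.

Lemma measurable_fat_cantor : measurable (fat_cantor : set RT).
Proof. exact: measurable_fat_cantor_cell. Qed.

Lemma fat_cantor_gt0 (x : R) : fat_cantor x -> 0 < x.
Proof.
move=> /fat_cantor_cell_sub; rewrite /cell /cell_left /= mul0r add0r in_itv/=.
by move=> /andP[].
Qed.

Lemma fat_cantor_le (x : R) : fat_cantor x -> x <= 1 + lam.
Proof.
move=> /fat_cantor_cell_sub; rewrite /cell /cell_left /cell_length /= mul0r !add0r in_itv/=.
by move=> /andP[_]; rewrite !expr0 mulr1.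
Qed.

Lemma leb_fat_cantor : leb fat_cantor = 1%:E.
Proof. by rewrite leb_fat_cantor_cell expr0. Qed.

Let C_ge0 (x : R) : fat_cantor x -> 0 <= x. Proof. by move/fat_cantor_gt0/ltW. Qed.

Let C_le1 : (leb fat_cantor <= 1)%E. Proof. by rewrite leb_fat_cantor. Qed.

Let C_mitv x y : x <= y -> leb (`]x, y] `&` fat_cantor) =
  (mass_upto fat_cantor y - mass_upto fat_cantor x)%:E.
Proof. by apply: mass_upto_itv => //; exact: measurable_fat_cantor. Qed.

Lemma mass_upto_cell_right n i : (i < 2 ^ n)%N ->
  mass_upto fat_cantor (cell_left n i + cell_length n) =
  mass_upto fat_cantor (cell_left n i) + 2^-1 ^+ n.
Proof.
move=> i2; have : (2^-1 ^+ n)%:E =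
    (mass_upto fat_cantor (cell_left n i + cell_length n) -
     mass_upto fat_cantor (cell_left n i))%:E.
  rewrite -C_mitv ?lerDl ?ltW ?cell_length_gt0// -/(cell n i) fat_cantorI_cell//.
  by rewrite leb_fat_cantor_cell.
by case=> ->; rewrite [RHS]addrC subrK.
Qed.

(** Each of the [i] cells of the same generation to the left carries the mass 2^-n. *)
Lemma mass_upto_cell n i : (i < 2 ^ n)%N ->
  mass_upto fat_cantor (cell_left n i) = i%:R * 2^-1 ^+ n.
Proof.
elim: n i => [i|n ih].
  rewrite expn0 ltnS leqn0 => /eqP ->; rewrite mul0r /cell_left/= mul0r addr0.
  by apply: mass_upto0 => //; exact: measurable_fat_cantor.
have h2 : (2 : R) * 2^-1 ^+ n.+1 = 2^-1 ^+ n by rewrite exprS mulVKf.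
apply: ltn_pow2S_ind => {}i i2; have {}ih := ih _ i2; split.
  by rewrite cell_left_even ih -muln2 natrM -mulrA h2.
rewrite cell_left_odd -cell_left_even mass_upto_cell_right; last first.
  by rewrite expnS mul2n ltn_double.
by rewrite cell_left_even ih -[i.*2.+1%:R]natr1 -muln2 natrM -h2; ring.
Qed.

Lemma gap_length_cell n i : (i < 2 ^ n)%N ->
  gap_length fat_cantor (cell_left n i) = cell_gap n i.
Proof.
by move=> i2; rewrite /gap_length mass_upto_cell// /cell_left addrAC subrr add0r.
Qed.

Lemma gap_length_cell_right n i : (i < 2 ^ n)%N ->
  gap_length fat_cantor (cell_left n i + cell_length n) =
  cell_gap n i + lam * 4^-1 ^+ n.
Proof.
move=> i2; rewrite /gap_length mass_upto_cell_right// mass_upto_cell//.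
by rewrite /cell_left /cell_length; ring.
Qed.

Lemma indic_fat_cantor_cell n i x : \1_(fat_cantor_cell n i) x =
  \1_(fat_cantor_cell n.+1 i.*2) x + \1_(fat_cantor_cell n.+1 i.*2.+1) x :> R.
Proof.
rewrite fat_cantor_cellE !indicE in_setU.
case: (boolP (x \in fat_cantor_cell n.+1 i.*2)) => [|_]; last by rewrite add0r.
rewrite inE => /fat_cantor_cell_sub h; rewrite memNset ?addr0//.
by move=> /fat_cantor_cell_sub; exact: cell_disj.
Qed.

Lemma indic_fat_cantor n x :
  \1_fat_cantor x = \sum_(i < 2 ^ n) \1_(fat_cantor_cell n i) x :> R.
Proof.
elim: n => [|n ih]; first by rewrite expn0 big_ord1.
rewrite ih (big_ord_pow2S n (fun i => \1_(fat_cantor_cell n.+1 i) x)).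
by apply: eq_bigr => i _; exact: indic_fat_cantor_cell.
Qed.

(** A cell carries the mass 2^-n, and on it [g] differs from its value at the left end by at most
    [B * cell_length n]; the masses add up to 1. *)
Lemma fat_cantor_Riemann (g : RT -> R) (B : R) n : measurable_fun [set: RT] g ->
    (exists M, forall x, `|g x| <= M) ->
    (forall x y, `|g x - g y| <= B * `|x - y|) ->
  `|\int[leb]_x (\1_fat_cantor x * g x) -
    \sum_(i < 2 ^ n) 2^-1 ^+ n * g (cell_left n i)| <= B * cell_length n.
Proof.
move=> mg gM gB; have B0 : 0 <= B.
  by have := gB 1 0; rewrite subr0 normr1 mulr1; exact: le_trans.
have bi i : bfs leb (\1_(fat_cantor_cell n i) : RT -> R).
  apply: bfs_indic; first exact: measurable_fat_cantor_cell.
  by rewrite [X in (X < _)%E]leb_fat_cantor_cell ltry.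
have bgi i : bfs leb (fun x => g x * \1_(fat_cantor_cell n i) x) by exact: bfsMl.
have -> : \int[leb]_x (\1_fat_cantor x * g x) =
    \sum_(i < 2 ^ n) \int[leb]_x (g x * \1_(fat_cantor_cell n i) x).
  rewrite -bfs_Rintegral_sum//; apply: eq_Rintegral => x _.
  by rewrite (indic_fat_cantor n) mulrC mulr_sumr.
have int1 i : \int[leb]_x (\1_(fat_cantor_cell n i) x : R) = 2^-1 ^+ n.
  rewrite Rintegral_indic; last exact: measurable_fat_cantor_cell.
  by rewrite [X in fine X]leb_fat_cantor_cell.
rewrite -sumrB (le_trans (ler_norm_sum _ _ _))//.
rewrite [leRHS](_ : _ = \sum_(i < 2 ^ n) (B * cell_length n) * 2^-1 ^+ n); last first.
  rewrite sumr_const card_ord -mulrnAr -mulr_natl natrX -exprMn divff// expr1n.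
  by rewrite mulr1.
apply: ler_sum => i _; rewrite -(int1 i) mulrC -!bfs_RintegralZ//.
rewrite -bfs_RintegralB//; last exact: bfsZ.
apply: bfs_normr_Rintegral; [by apply: bfsB => //; exact: bfsZ|exact: bfsZ|].
move=> x; rewrite -mulrBl normrM [X in _ * X]ger0_norm// indicE.
case: (boolP (x \in _)) => [|_]; last by rewrite !mulr0.
rewrite inE !mulr1 => /fat_cantor_cell_sub; rewrite /cell/= in_itv/= => /andP[h1 h2].
by rewrite (le_trans (gB _ _))// ler_wpM2l// ger0_norm; lra.
Qed.

End fat_cantor.

Arguments cell_gap : simpl never.

(** * The flux through a corner region *)

Section real_integrals.
Variable R : realType.
Notation leb := (@lebesgue_measure R).
Notation RT := (measurableTypeR R).

Lemma measurable_natb d (T : measurableType d) (b : T -> bool) :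
  measurable_fun [set: T] b -> measurable_fun [set: T] (fun x => (b x)%:R : RT).
Proof.
move=> mb; have -> : (fun x => (b x)%:R : RT) = \1_(b @^-1` [set true]).
  apply/funext => x; rewrite indicE; congr (_%:R); congr nat_of_bool.
  by apply/idP/idP; rewrite inE.
by apply: measurable_indic; rewrite -[X in measurable X]setTI; exact: mb.
Qed.

Lemma bfs_itv (g : RT -> R) (a b M : R) : measurable_fun [set: RT] g ->
  (forall x, `|g x| <= M) -> (forall x, g x != 0 -> a <= x <= b) -> bfs leb g.
Proof.
move=> mg gM g0; split => //; exists `[a, b]%classic, M; split => //.
  by rewrite [X in (X < _)%E]lebesgue_measure_itv; case: ifPn => _; rewrite ?ltry.
move=> x; rewrite indicE; have [->|/g0 xab] := eqVneq (g x) 0.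
  by rewrite normr0 mulr_ge0// (le_trans _ (gM x)).
by rewrite mem_set ?mulr1//= in_itv.
Qed.

Lemma bfs2_itv (g : RT * RT -> R) (a b M : R) : measurable_fun [set: RT * RT] g ->
  (forall p, `|g p| <= M) ->
  (forall p, g p != 0 -> a <= p.1 <= b /\ a <= p.2 <= b) -> bfs2 leb leb g.
Proof.
move=> mg gM g0; split => //; exists `[a, b]%classic, `[a, b]%classic, M.
have Ifin : measurable (`[a, b]%classic : set RT) /\ (leb `[a, b]%classic < +oo)%E.
  split; first exact: measurable_itv.
  by rewrite [X in (X < _)%E]lebesgue_measure_itv; case: ifPn => _; rewrite ?ltry.
split => // p; rewrite !indicE; have [->|/g0[xab yab]] := eqVneq (g p) 0.
  by rewrite normr0 !mulr_ge0// (le_trans _ (gM p)).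
by rewrite !mem_set ?mulr1//= in_itv.
Qed.

Lemma Rintegral_natb (b : RT -> bool) (A : set RT) (g : RT -> R) :
  (forall x, b x = (x \in A)) ->
  \int[leb]_x ((b x)%:R * g x) = \int[leb]_(x in A) g x.
Proof.
move=> bA; rewrite [RHS]Rintegral_mkcond; apply: eq_Rintegral => x _.
by rewrite patchE bA; case: ifPn => _; rewrite ?mul1r ?mul0r.
Qed.

(** The interval enters as a boolean factor on the whole line, so that the section of a region by a
    line can be recognized inside the integrand. *)
Lemma FTC_oo (g g' : R -> R) (a b : R) : a <= b ->
  (forall x : R, is_derive x (1 : R) g (g' x)) -> continuous g' ->
  \int[leb]_x (((a < x) && (x < b))%:R * g' x) = g b - g a.
Proof.
rewrite le_eqVlt => /predU1P[<- _ _|ab dg cg'].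
  rewrite subrr; apply: Rintegral_eq0 => x.
  by case: (ltP a x) => //= ax; rewrite ?mul0r// ltNge (ltW ax) mul0r.
have cg : continuous g.
  by move=> x; apply: differentiable_continuous; apply/derivable1_diffP; case: (dg x).
have gi A : A `<=` `[a, b] -> measurable (A : set RT) ->
    leb.-integrable A (EFin \o g').
  move=> Aab mA; apply: (integrableS _ mA Aab); first exact: measurable_itv.
  apply: continuous_compact_integrable; first exact: segment_compact.
  exact: continuous_subspaceT.
rewrite (@Rintegral_natb (fun x => (a < x) && (x < b)) `]a, b[%classic); last first.
  by move=> x; rewrite mem_setE in_itv.
rewrite Rintegral_itv_obnd_cbnd; last by apply: gi => //; exact: subset_itv_oo_cc.
rewrite Rintegral_itv_bndo_bndc; last by apply: gi => //; exact: subset_itv_co_cc.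
rewrite /Rintegral (@continuous_FTC2 _ g' g)//.
- exact: continuous_subspaceT.
- split.
  + by move=> x _; case: (dg x).
  + exact: cvg_at_right_filter (cg a).
  + exact: cvg_at_left_filter (cg b).
- by move=> x _; rewrite derive1E; apply: derive_val.
Qed.

(** Serves beside the open form because a [corner] contains its side x = [x0] but not its level
    line. *)
Lemma FTC_oc (g g' : R -> R) (a b : R) : a <= b ->
  (forall x : R, is_derive x (1 : R) g (g' x)) -> continuous g' ->
  \int[leb]_x (((a < x) && (x <= b))%:R * g' x) = g b - g a.
Proof.
move=> ab dg cg'; rewrite -(FTC_oo ab dg cg').
rewrite (@Rintegral_natb (fun x => (a < x) && (x < b)) `]a, b[%classic); last first.
  by move=> x; rewrite mem_setE in_itv.
rewrite (@Rintegral_natb (fun x => (a < x) && (x <= b)) `]a, b]%classic); last first.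
  by move=> x; rewrite mem_setE in_itv.
rewrite Rintegral_itv_bndo_bndc//.
have mab : measurable (`]a, b[%classic : set RT) by exact: measurable_itv.
have sab : `]a, b[%classic `<=` `[a, b]%classic by exact: subset_itv_oo_cc.
apply: (integrableS _ mab sab); first exact: measurable_itv.
apply: continuous_compact_integrable; first exact: segment_compact.
exact: continuous_subspaceT.
Qed.

End real_integrals.

Section corner.
Variable R : realType.
Notation leb := (@lebesgue_measure R).
Notation RT := (measurableTypeR R).

(** Derivatives and their continuity are required along the coordinate lines only, where the
    fundamental theorem of calculus is applied. The one constant [B] also serves as Lipschitz
    constant in each variable. *)
Record C1_bounded (B : R) (f f1 f2 : RT * RT -> R) : Prop := {
  C1b_meas : measurable_fun [set: RT * RT] f;
  C1b_meas1 : measurable_fun [set: RT * RT] f1;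
  C1b_meas2 : measurable_fun [set: RT * RT] f2;
  C1b_der1 : forall x y : R, is_derive x (1 : R) (fun t : R => f (t, y)) (f1 (x, y));
  C1b_der2 : forall x y : R, is_derive y (1 : R) (fun t : R => f (x, t)) (f2 (x, y));
  C1b_cont1 : forall y : R, continuous (fun t : R => f1 (t, y));
  C1b_cont2 : forall x : R, continuous (fun t : R => f2 (x, t));
  C1b_bound : forall p, `|f p| <= B;
  C1b_bound1 : forall p, `|f1 p| <= B;
  C1b_bound2 : forall p, `|f2 p| <= B }.

Variables C1 C2 : set RT.
Hypotheses (mC1 : measurable C1) (C1_ge0 : forall x : R, C1 x -> 0 <= x)
  (C1_le1 : (leb C1 <= 1)%E).
Hypotheses (mC2 : measurable C2) (C2_ge0 : forall x : R, C2 x -> 0 <= x)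
  (C2_le1 : (leb C2 <= 1)%E).

Local Notation F := (gap_length C1).
Local Notation G := (gap_length C2).
Local Notation P := (gap_inv C1).
Local Notation Q := (gap_inv C2).

Definition corner (h x0 : R) (p : RT * RT) : bool :=
  [&& 0 < p.1, p.1 <= x0, 0 < p.2 & F p.1 + G p.2 < h].

(* The integral of [s v . grad f], where v = (1_(~` C2) y, - 1_(~` C1) x) is the
   rotated gradient of the stream function F x + G y. *)
Definition gap_flux (s f1 f2 : RT * RT -> R) : R :=
  \int[(leb \x leb)%E]_p
    (s p * (\1_(~` C2) p.2 * f1 p - \1_(~` C1) p.1 * f2 p)).

Lemma measurable_corner h x0 : measurable_fun [set: RT * RT] (corner h x0).
Proof.
rewrite /corner; apply: measurable_and; first exact: measurable_fun_ltr.
apply: measurable_and; first exact: measurable_fun_ler.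
apply: measurable_and; first exact: measurable_fun_ltr.
apply: measurable_fun_ltr => //; apply: measurable_funD.
  by apply: measurableT_comp measurable_fst; exact: measurable_gap_length.
by apply: measurableT_comp measurable_snd; exact: measurable_gap_length.
Qed.

Lemma corner_bound h x0 p : corner h x0 p ->
  0 <= p.1 <= `|x0| + `|h| + 1 /\ 0 <= p.2 <= `|x0| + `|h| + 1.
Proof.
move=> /and4P[x0p xp yp FG].
have := gap_length_ge0 mC1 C1_ge0 C1_le1 (ltW x0p).
have := gap_length_ge mC2 C2_le1 p.2.
have := ler_norm x0; have := ler_norm h; have := normr_ge0 x0; have := normr_ge0 h.
by move=> *; split; apply/andP; split; lra.
Qed.

Let indic_le1 (C : set RT) x : `|\1_C x : R| <= 1.
Proof. by rewrite indicE ger0_norm// lern1 leq_b1. Qed.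

Let mindic1 (C : set RT) : measurable C ->
  measurable_fun [set: RT * RT] (fun p => \1_(~` C) p.1 : R).
Proof.
move=> mC; apply: measurableT_comp measurable_fst.
by apply: measurable_indic; exact: measurableC.
Qed.

Let mindic2 (C : set RT) : measurable C ->
  measurable_fun [set: RT * RT] (fun p => \1_(~` C) p.2 : R).
Proof.
move=> mC; apply: measurableT_comp measurable_snd.
by apply: measurable_indic; exact: measurableC.
Qed.

Lemma bfs2_corner h x0 : bfs2 leb leb (fun p => (corner h x0 p)%:R : R).
Proof.
apply: (@bfs2_itv _ _ 0 (`|x0| + `|h| + 1) 1).
- by apply: measurable_natb; exact: measurable_corner.
- by move=> p; rewrite ger0_norm// lern1 leq_b1.
- move=> p; case: (boolP (corner h x0 p)) => [+ _|]; last by rewrite eqxx.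
  exact: corner_bound.
Qed.

Lemma bfs2_gap_flux B f f1 f2 s : C1_bounded B f f1 f2 -> bfs2 leb leb s ->
  bfs2 leb leb (fun p => s p * (\1_(~` C2) p.2 * f1 p)) /\
  bfs2 leb leb (fun p => s p * (\1_(~` C1) p.1 * f2 p)).
Proof.
move=> Cf bs; split.
  under eq_fun do rewrite mulrC; apply: (bfs2Ml _ _ bs).
    by apply: measurable_funM; [exact: mindic2|exact: C1b_meas1 Cf].
  exists B => p; rewrite normrM (le_trans _ (C1b_bound1 Cf p))// ler_piMl//.
under eq_fun do rewrite mulrC; apply: (bfs2Ml _ _ bs).
  by apply: measurable_funM; [exact: mindic1|exact: C1b_meas2 Cf].
exists B => p; rewrite normrM (le_trans _ (C1b_bound2 Cf p))// ler_piMl//.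
Qed.

(** The two terms are integrated in opposite orders, so that each inner integral runs in the
    direction of its derivative. *)
Lemma gap_fluxE B f f1 f2 s : C1_bounded B f f1 f2 -> bfs2 leb leb s ->
  gap_flux s f1 f2 =
  \int[leb]_y \int[leb]_x (s (x, y) * (\1_(~` C2) y * f1 (x, y))) -
  \int[leb]_x \int[leb]_y (s (x, y) * (\1_(~` C1) x * f2 (x, y))).
Proof.
move=> Cf bs; have [b1 b2] := bfs2_gap_flux Cf bs.
rewrite /gap_flux; under eq_Rintegral do rewrite mulrBr.
rewrite bfs_RintegralB; [|exact: bfs2_bfs|exact: bfs2_bfs].
by rewrite (bfs2_Fubini1 b1) (bfs2_Fubini2 b2).
Qed.

(* By the fundamental theorem of calculus both terms of the flux become
   integrals of [f] over the boundary of the corner. On the level line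
   F x + G y = h they cancel, after the change of variables along F and G, and
   only the side x = x0 is left. *)
Lemma corner_flux B f f1 f2 (h x0 : R) : C1_bounded B f f1 f2 ->
    (forall y : R, f (0, y) = 0) -> (forall x : R, f (x, 0) = 0) -> 0 <= x0 ->
  gap_flux (fun p => (corner h x0 p)%:R) f1 f2 =
  \int[leb]_t (((0 < t) && (t < h - F x0))%:R * f (x0, Q t)).
Proof.
move=> Cf f0y fx0 x0_ge0; have mf := C1b_meas Cf.
have mF := measurable_gap_length mC1 C1_le1.
have mG := measurable_gap_length mC2 C2_le1.
have mP := measurable_gap_inv mC1 C1_le1.
have mQ := measurable_gap_inv mC2 C2_le1.
rewrite (gap_fluxE Cf (bfs2_corner h x0)).
(* The value of [f] where the horizontal line at height [y] leaves the corner, through the side x =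
   [x0] or through the level line, whichever comes first. Its analogue [b] is for vertical lines,
   which leave through the level line only. *)
pose a (y : RT) : R :=
  ((0 < y) && (G y < h))%:R * f (Num.min x0 (P (h - G y)), y).
pose b (x : RT) : R :=
  ([&& 0 < x, x <= x0 & F x < h])%:R * f (x, Q (h - F x)).
have ba : bfs leb a.
  apply: (@bfs_itv _ _ 0 (`|h| + 1) B).
  - apply: measurable_funM.
      apply: measurable_natb; apply: measurable_and; first exact: measurable_fun_ltr.
      exact: measurable_fun_ltr.
    apply: measurableT_comp => //; apply: measurable_fun_pair => //.
    apply: measurable_minr => //; apply: measurableT_comp => //.
    exact: measurable_funB.
  - move=> y; rewrite /a normrM (le_trans _ (C1b_bound Cf (Num.min x0 (P (h - G y)), y)))//.
    by rewrite ler_piMl// ger0_norm// lern1 leq_b1.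
  - move=> y; rewrite /a; case: (ltP 0 y) => [y0|]; last by rewrite mul0r eqxx.
    case: (ltP (G y) h) => [yh _|]; last by rewrite mul0r eqxx.
    by have := gap_length_ge mC2 C2_le1 y; have := ler_norm h => ? ?; apply/andP; split; lra.
have bb : bfs leb b.
  apply: (@bfs_itv _ _ 0 x0 B).
  - apply: measurable_funM.
      apply: measurable_natb; apply: measurable_and; first exact: measurable_fun_ltr.
      by apply: measurable_and; [exact: measurable_fun_ler|exact: measurable_fun_ltr].
    apply: measurableT_comp => //; apply: measurable_fun_pair => //.
    by apply: measurableT_comp => //; exact: measurable_funB.
  - move=> x; rewrite /b normrM (le_trans _ (C1b_bound Cf (x, Q (h - F x))))//.
    by rewrite ler_piMl// ger0_norm// lern1 leq_b1.
  - move=> x; rewrite /b; case: (ltP 0 x) => [y0|]; last by rewrite mul0r eqxx.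
    by case: (leP x x0) => [xx0 _|]; rewrite ?mul0r ?eqxx// ltW.
have inner1 y : \int[leb]_x ((corner h x0 (x, y))%:R * (\1_(~` C2) y * f1 (x, y))) =
    \1_(~` C2) y * a y.
  transitivity (\int[leb]_x (\1_(~` C2) y * ((corner h x0 (x, y))%:R * f1 (x, y)))).
    by apply: eq_Rintegral => x _; rewrite mulrCA.
  rewrite bfs_RintegralZ; last first.
    apply: (@bfs2_slice1 _ _ _ _ _ _ _ (fun p => (corner h x0 p)%:R * f1 p)).
    under eq_fun do rewrite mulrC.
    apply: bfs2Ml (bfs2_corner _ _); first exact: C1b_meas1 Cf.
    by exists B; exact: C1b_bound1 Cf.
  congr (_ * _); rewrite /a /corner/=.
  case: (ltP 0 y) => [y0|_] /=; last first.
    rewrite mul0r; apply: Rintegral_eq0 => x.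
    by rewrite !andbF mul0r.
  case: (ltP (G y) h) => Gh /=; last first.
    rewrite mul0r; apply: Rintegral_eq0 => x.
    case: (ltP 0 x) => x_gt0; last by rewrite mul0r.
    case: (ltP (F x + G y) h) => /=; rewrite ?andbF ?mul0r//.
    by have := gap_length_ge0 mC1 C1_ge0 C1_le1 (ltW x_gt0); lra.
  rewrite mul1r; have [Fh|Fh] := ltP (F x0) (h - G y).
    have -> : Num.min x0 (P (h - G y)) = x0.
      by apply/min_idPl; rewrite ltW// gap_inv_ltE.
    have <- : f (x0, y) - f (0, y) = f (x0, y) by rewrite f0y subr0.
    rewrite -(FTC_oc x0_ge0 (fun x => C1b_der1 Cf x y) (@C1b_cont1 _ _ _ _ Cf y)).
    apply: eq_Rintegral => x _; congr (_%:R * _); congr nat_of_bool.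
    case: (ltP 0 x) => //= _; case: (leP x x0) => //= xx0.
    by have := gap_length_nd mC1 C1_le1 xx0 => ?; apply/idP; lra.
  have -> : Num.min x0 (P (h - G y)) = P (h - G y).
    by apply/min_idPr; rewrite gap_inv_leE.
  have <- : f (P (h - G y), y) - f (0, y) = f (P (h - G y), y) by rewrite f0y subr0.
  have P0 : 0 <= P (h - G y) by rewrite ltW// gap_inv_gt0// subr_gt0.
  rewrite -(FTC_oo P0 (fun x => C1b_der1 Cf x y) (@C1b_cont1 _ _ _ _ Cf y)).
  apply: eq_Rintegral => x _; congr (_%:R * _); congr nat_of_bool.
  rewrite gap_inv_ltE// ltrBrDr; case: (ltP 0 x) => //= _.
  case: (leP x x0) => //= xx0.
  by have := gap_length_nd mC1 C1_le1 (ltW xx0) => ?; apply/esym/negbTE; rewrite -leNgt; lra.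
have inner2 x : \int[leb]_y ((corner h x0 (x, y))%:R * (\1_(~` C1) x * f2 (x, y))) =
    \1_(~` C1) x * b x.
  transitivity (\int[leb]_y (\1_(~` C1) x * ((corner h x0 (x, y))%:R * f2 (x, y)))).
    by apply: eq_Rintegral => y _; rewrite mulrCA.
  rewrite bfs_RintegralZ; last first.
    apply: (@bfs2_slice2 _ _ _ _ _ _ _ (fun p => (corner h x0 p)%:R * f2 p)).
    under eq_fun do rewrite mulrC.
    apply: bfs2Ml (bfs2_corner _ _); first exact: C1b_meas2 Cf.
    by exists B; exact: C1b_bound2 Cf.
  congr (_ * _); rewrite /b /corner/=.
  case: (ltP 0 x) => [x_gt0|_] /=; last first.
    rewrite mul0r; apply: Rintegral_eq0 => y.
    by rewrite mul0r.
  case: (leP x x0) => [xx0|_] /=; last first.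
    rewrite mul0r; apply: Rintegral_eq0 => y.
    by rewrite mul0r.
  case: (ltP (F x) h) => Fh /=; last first.
    rewrite mul0r; apply: Rintegral_eq0 => y.
    case: (ltP 0 y) => y0; last by rewrite mul0r.
    case: (ltP (F x + G y) h) => /=; rewrite ?mul0r//.
    by have := gap_length_ge0 mC2 C2_ge0 C2_le1 (ltW y0); lra.
  rewrite mul1r.
  have <- : f (x, Q (h - F x)) - f (x, 0) = f (x, Q (h - F x)) by rewrite fx0 subr0.
  have Q0 : 0 <= Q (h - F x) by rewrite ltW// gap_inv_gt0// subr_gt0.
  rewrite -(FTC_oo Q0 (fun y => C1b_der2 Cf x y) (@C1b_cont2 _ _ _ _ Cf x)).
  apply: eq_Rintegral => y _; congr (_%:R * _); congr nat_of_bool.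
  by rewrite gap_inv_ltE// ltrBrDl.
under eq_Rintegral do rewrite inner1.
under [X in _ - X = _]eq_Rintegral do rewrite inner2.
rewrite (gap_transport mC2 C2_le1 ba) (gap_transport mC1 C1_le1 bb).
have baQ : bfs leb (a \o Q).
  apply: (bfs_transport mC2 (gap_mass_fin C2_le1) mQ) ba; exact: gap_transport_itv.
have bbP : bfs leb (b \o P).
  apply: (bfs_transport mC1 (gap_mass_fin C1_le1) mP) bb; exact: gap_transport_itv.
(* The variables are now t = G y in the first integral and F x in the second. On the level line they
   add up to [h], so the reflection at [h] brings both integrals to the same variable. *)
rewrite -(lebesgue_reflection h bbP) -bfs_RintegralB//; last exact: bfs_reflection.
apply: eq_Rintegral => t _; rewrite /a /b/=.
rewrite !gap_inv_gt0// !gap_lengthK// gap_inv_leE//.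
have -> : h - (h - t) = t by lra.
have [t0|t0] := ltP 0 t; last first.
  rewrite !mul0r sub0r (_ : _ < h = false) ?andbF ?mul0r ?oppr0//.
  by apply/negbTE; rewrite -leNgt; lra.
have -> : (0 < h - t) = (t < h) by rewrite subr_gt0.
have -> : (h - t < h) by lra.
rewrite andbT /=; have [th|th] := ltP t h; last first.
  rewrite !mul0r subr0 (_ : t < _ = false) ?mul0r//.
  apply/negbTE; rewrite -leNgt; have := gap_length_ge0 mC1 C1_ge0 C1_le1 x0_ge0; lra.
rewrite /= mul1r; have [hF|hF] := leP (h - t) (F x0).
  have -> : Num.min x0 (P (h - t)) = P (h - t) by apply/min_idPr; rewrite gap_inv_leE.
  rewrite mul1r subrr (_ : t < _ = false) ?mul0r//.
  by apply/negbTE; rewrite -leNgt; lra.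
have -> : Num.min x0 (P (h - t)) = x0 by apply/min_idPl; rewrite ltW// gap_inv_ltE.
by rewrite mul0r subr0 (_ : t < _) ?mul1r//; lra.
Qed.

End corner.

(** * The part of the level lines upstream of the Cantor dust *)

Lemma Rintegral_ae1 (R : realType) (g : measurableTypeR R -> R) (a : R) :
  (forall x, x != a -> g x = 0) -> \int[@lebesgue_measure R]_x g x = 0.
Proof.
move=> ga; rewrite -(Rintegral_set1 g a) [RHS]Rintegral_mkcond.
apply: eq_Rintegral => x _; rewrite patchE; case: ifPn => // xa.
by apply: ga; apply: contraNneq xa => ->; rewrite inE.
Qed.

Lemma itvb_split (R : realDomainType) (a b c x : R) : a <= b -> b <= c ->
  (a <= x < b)%R%:R + (b <= x < c)%R%:R = (a <= x < c)%R%:R :> R.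
Proof.
move=> ab bc; have [xb|bx] := ltP x b; have [ax|xa] := leP a x => /=.
- by rewrite addr0 (lt_le_trans xb bc).
- by rewrite add0r.
- by rewrite add0r.
- by move: (le_lt_trans ab (le_lt_trans bx xa)); rewrite ltxx.
Qed.

Lemma big_ord2_pow2S (R : nmodType) n (f : nat -> nat -> R) :
  \sum_(i < 2 ^ n.+1) \sum_(k < 2 ^ n.+1) f i k =
  \sum_(i < 2 ^ n) \sum_(k < 2 ^ n)
    ((f i.*2 k.*2 + f i.*2 k.*2.+1) + (f i.*2.+1 k.*2 + f i.*2.+1 k.*2.+1)).
Proof.
rewrite (big_ord_pow2S n (fun i => \sum_(k < 2 ^ n.+1) f i k)).
apply: eq_bigr => i _; rewrite !(big_ord_pow2S n) -big_split/=.
by apply: eq_bigr => k _.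
Qed.

Section upstream.
Variable R : realType.
Notation leb := (@lebesgue_measure R).
Notation RT := (measurableTypeR R).

Local Notation C1 := (@fat_cantor R 2).
Local Notation C2 := (@fat_cantor R 1).
Local Notation F := (gap_length C1).
Local Notation G := (gap_length C2).
Local Notation Q := (gap_inv C2).
Local Notation xl := (@cell_left R 2).
Local Notation yl := (@cell_left R 1).
Local Notation xg := (@cell_gap R 2).
Local Notation yg := (@cell_gap R 1).
Local Notation flux := (gap_flux C1 C2).
Local Notation q n := (4^-1 ^+ n : R).

Let lam2 : (0 : R) < 2. Proof. by []. Qed.
Let lam1 : (0 : R) < 1. Proof. by []. Qed.
Let mC1 : measurable (C1 : set RT). Proof. exact: measurable_fat_cantor. Qed.
Let mC2 : measurable (C2 : set RT). Proof. exact: measurable_fat_cantor. Qed.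
Let C1_ge0 (x : R) : C1 x -> 0 <= x. Proof. by move/fat_cantor_gt0/ltW. Qed.
Let C2_ge0 (x : R) : C2 x -> 0 <= x. Proof. by move/fat_cantor_gt0/ltW. Qed.
Let C1_le1 : (leb C1 <= 1)%E. Proof. by rewrite leb_fat_cantor. Qed.
Let C2_le1 : (leb C2 <= 1)%E. Proof. by rewrite leb_fat_cantor. Qed.
Let q_gt0 n : 0 < q n. Proof. by rewrite exprn_gt0. Qed.
Let qS n : q n = 4 * q n.+1. Proof. by rewrite exprS mulVKf. Qed.

Definition level (p : RT * RT) : R := F p.1 + G p.2.

(* For [C1] the gaps are sums of digits 2 d_k 4^-k and for [C2] of e_k 4^-k, so
   the sums [xg n i + yg n k] run over the multiples of 4^-n in [0, 1[ without
   repetition: each level in [0, 1[ belongs to exactly one pair of cells. *)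
Definition strip n i k (p : RT * RT) : bool :=
  [&& 0 < p.1, p.1 <= xl n i, 0 < p.2 &
    xg n i + yg n k <= level p < xg n i + yg n k + q n].

(** Stage [n] stops a level line in the first quadrant, of level in [0, 1[, at the left end of the
    cell of [C1] assigned to its level, shortly before the dust. *)
Definition upstream_ n (p : RT * RT) : R :=
  \sum_(i < 2 ^ n) \sum_(k < 2 ^ n) (strip n i k p)%:R.

Definition upstream (p : RT * RT) : R := limn (fun n => upstream_ n p).

Lemma stripE n i k p : (strip n i k p)%:R =
  (corner C1 C2 (xg n i + yg n k + q n) (xl n i) p)%:R -
  (corner C1 C2 (xg n i + yg n k) (xl n i) p)%:R :> R.
Proof.
rewrite /strip /corner -/(level p); case: (0 < p.1) => /=; rewrite ?subrr//.
case: (p.1 <= _) => /=; rewrite ?subrr//.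
case: (0 < p.2) => /=; rewrite ?subrr//.
have [h1|h1] := leP (xg n i + yg n k) (level p); first by rewrite subr0.
by rewrite (lt_trans h1) ?subrr// ltrDl.
Qed.

(** With r = 4^-(n+1), the level ranges of the four pairs of children start at the offsets 0, r, 2 r
    and 3 r and have length r, so that they tile the range of the parents. *)
Lemma level_cells n p :
  \sum_(i < 2 ^ n) \sum_(k < 2 ^ n)
    (xg n i + yg n k <= level p < xg n i + yg n k + q n)%R%:R =
  (0 <= level p < 1)%R%:R :> R.
Proof.
elim: n => [|n ih]; first by rewrite !expn0 !big_ord1 /cell_gap/= !addr0 add0r expr0.
rewrite -ih (big_ord2_pow2S n (fun i k => (xg n.+1 i + yg n.+1 k <= level p <
  xg n.+1 i + yg n.+1 k + q n.+1)%R%:R : R)).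
apply: eq_bigr => i _; apply: eq_bigr => k _.
rewrite !cell_gap_even !cell_gap_odd (qS n) mul1r; set h := xg n i; set h' := yg n k.
have q0 := q_gt0 n.+1; move: (q n.+1) q0 => r r0.
have -> : h + (h' + r) = h + h' + r by ring.
rewrite itvb_split; [|lra|lra].
have -> : h + 2 * r + h' = h + h' + r + r by ring.
have -> : h + 2 * r + (h' + r) = h + h' + r + r + r by ring.
rewrite [X in _ + X]itvb_split; [|lra|lra].
rewrite itvb_split; [|lra|lra].
by congr (_%:R); congr (_ && (_ < _)); ring.
Qed.

Lemma upstream_ge0_ n p : 0 <= upstream_ n p.
Proof. by rewrite sumr_ge0// => i _; rewrite sumr_ge0. Qed.

Lemma upstream_le_ n p : upstream_ n p <= (corner C1 C2 1 2 p)%:R.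
Proof.
have [p10|p10] := ltP 0 p.1; last first.
  rewrite [leLHS](_ : _ = 0)//; apply: big1 => i _; apply: big1 => k _.
  by rewrite /strip ltNge p10.
have [p20|p20] := ltP 0 p.2; last first.
  rewrite [leLHS](_ : _ = 0)//; apply: big1 => i _; apply: big1 => k _.
  by rewrite /strip (ltNge 0 p.2) p20/= !andbF.
apply: (@le_trans _ _ ((0 <= level p < 1)%R%:R)).
  rewrite -(level_cells n p); apply: ler_sum => i _; apply: ler_sum => k _.
  by rewrite /strip p10 p20/=; case: (p.1 <= _).
rewrite /corner p10 p20/= -/(level p); case: (ltP (level p) 1) => [l1|]; last by rewrite andbF.
(* [F] lags behind the identity by at most the mass 1 of [C1], so a level below 1 forces x < 2: the
   side x = 2 cuts nothing off. *)
rewrite andbT andbT; suff -> : p.1 <= 2 by case: (0 <= _).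
have := gap_length_ge mC1 C1_le1 p.1.
have := gap_length_ge0 mC2 C2_ge0 C2_le1 (ltW p20).
by move: l1; rewrite /level; lra.
Qed.

(** The level range of a pair of cells is divided among the four pairs of children, whose left ends
    in x are not to the left of [xl n i]: strips are only prolonged. *)
Lemma upstream_nd p : nondecreasing_seq (fun n => upstream_ n p).
Proof.
apply/nondecreasing_seqP => n.
rewrite /upstream_ (big_ord2_pow2S n (fun i k => (strip n.+1 i k p)%:R : R)).
apply: ler_sum => i _; apply: ler_sum => k _.
rewrite /strip; case: (0 < p.1); rewrite //= ?addr_ge0//.
case: (0 < p.2); rewrite /= ?andbF ?addr_ge0//.
rewrite cell_left_even cell_left_odd; case: (leP p.1 (xl n i)) => px /=; last first.
  by rewrite !addr_ge0.
rewrite (le_trans px) ?lerDl ?(ltW (cell_length_gt0 _ _))//=.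
rewrite !cell_gap_even !cell_gap_odd (qS n) mul1r; set h := xg n i; set h' := yg n k.
have q0 := q_gt0 n.+1; move: (q n.+1) q0 => r r0.
have -> : h + (h' + r) = h + h' + r by ring.
rewrite itvb_split; [|lra|lra].
have -> : h + 2 * r + h' = h + h' + r + r by ring.
have -> : h + 2 * r + (h' + r) = h + h' + r + r + r by ring.
rewrite [X in _ <= _ + X]itvb_split; [|lra|lra].
rewrite itvb_split; [|lra|lra].
by have -> : h + h' + 4 * r = h + h' + r + r + r + r by ring.
Qed.

Lemma upstream_cvg p : upstream_ n p @[n --> \oo] --> upstream p.
Proof.
apply: nondecreasing_is_cvgn; first exact: upstream_nd.
by exists (corner C1 C2 1 2 p)%:R => _ [n _ <-]; exact: upstream_le_.
Qed.

Lemma upstream_ge0 p : 0 <= upstream p.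
Proof.
apply: limr_ge; first exact: (cvgP _ (@upstream_cvg p)).
by apply: nearW => n; exact: upstream_ge0_.
Qed.

Lemma upstream_le p : upstream p <= (corner C1 C2 1 2 p)%:R.
Proof.
apply: limr_le; first exact: (cvgP _ (@upstream_cvg p)).
by apply: nearW => n; exact: upstream_le_.
Qed.

(** Absorbs the cut-off factor of the field into [upstream]. *)
Lemma upstream_corner p : upstream p * (corner C1 C2 1 2 p)%:R = upstream p.
Proof.
have := upstream_le p; have := upstream_ge0 p.
case: (corner C1 C2 1 2 p); rewrite ?mulr1// mulr0 => h1 h2.
by apply/eqP; rewrite eq_le h1.
Qed.

Lemma bfs2_corner12 : bfs2 leb leb (fun p => (corner C1 C2 1 2 p)%:R : R).
Proof. exact: bfs2_corner. Qed.

Lemma bfs2_strip n i k : bfs2 leb leb (fun p => (strip n i k p)%:R : R).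
Proof.
have bC := bfs2_corner mC1 C1_ge0 C1_le1 mC2 C2_le1.
apply: (bfs2_le _ _ (bC (xg n i + yg n k + q n) (xl n i))).
  under eq_fun do rewrite stripE.
  by apply: measurable_funB; apply: measurable_natb; exact: measurable_corner.
exists 1 => p; rewrite mul1r !ger0_norm// /strip /corner -/(level p).
case: (0 < p.1) => //=; case: (p.1 <= _) => //=; case: (0 < p.2) => //=.
by case: (xg n i + yg n k <= level p); case: (level p < _).
Qed.

Lemma measurable_upstream_ n : measurable_fun [set: RT * RT] (upstream_ n).
Proof.
rewrite /upstream_; apply: measurable_sum => i; apply: measurable_sum => k.
by case: (bfs2_strip n i k).
Qed.

Lemma measurable_upstream : measurable_fun [set: RT * RT] upstream.
Proof. by apply: (measurable_fun_cvg measurable_upstream_) => p _; exact: upstream_cvg. Qed.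

Lemma bfs2_upstream : bfs2 leb leb upstream.
Proof.
have bC := bfs2_corner mC1 C1_ge0 C1_le1 mC2 C2_le1.
apply: (bfs2_le measurable_upstream _ (bC 1 2)).
exists 1 => p; rewrite mul1r [leRHS]ger0_norm// ger0_norm ?upstream_ge0//.
exact: upstream_le.
Qed.

(** * The flux of the upstream region as a limit of Riemann sums over the dust *)

Section flux_limit.
Variables (B : R) (f f1 f2 : RT * RT -> R).
Hypothesis Cf : C1_bounded B f f1 f2.
Hypothesis f0y : forall y : R, f (0, y) = 0.
Hypothesis fx0 : forall x : R, f (x, 0) = 0.

Let B_ge0 : 0 <= B. Proof. exact: le_trans (C1b_bound Cf (0, 0)). Qed.

(** Since F 2 >= 1, the level line of level 1 ends before x = 2, and the range of integration over
    that side is empty. This makes the cut-off field divergence-free. *)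
Lemma corner_flux0 : flux (fun p => (corner C1 C2 1 2 p)%:R) f1 f2 = 0.
Proof.
rewrite (corner_flux mC1 C1_ge0 C1_le1 mC2 C2_ge0 C2_le1 _ Cf f0y fx0)//.
apply: Rintegral_eq0 => t; rewrite (_ : _ && _ = false) ?mul0r//.
apply/negbTE/negP => /andP[t0 t1].
by have := gap_length_ge mC1 C1_le1 2; lra.
Qed.

Lemma C1_bounded_lip1 (x x' y : R) : `|f (x, y) - f (x', y)| <= B * `|x - x'|.
Proof.
wlog xx' : x x' / x' <= x.
  move=> H; case: (leP x' x) => [|/ltW] xx'; first exact: H.
  by rewrite distrC (distrC x); exact: H.
have cf : continuous (fun t : R => f (t, y)).
  move=> z; apply: differentiable_continuous; apply/derivable1_diffP.
  by case: (C1b_der1 Cf z y).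
have [c _ ->] := MVT_segment xx' (fun z _ => C1b_der1 Cf z y) (continuous_subspaceT cf).
by rewrite normrM ler_wpM2r// (C1b_bound1 Cf).
Qed.

Lemma C1_bounded_lip2 (x y y' : R) : `|f (x, y) - f (x, y')| <= B * `|y - y'|.
Proof.
wlog yy' : y y' / y' <= y.
  move=> H; case: (leP y' y) => [|/ltW] yy'; first exact: H.
  by rewrite distrC (distrC y); exact: H.
have cf : continuous (fun t : R => f (x, t)).
  move=> z; apply: differentiable_continuous; apply/derivable1_diffP.
  by case: (C1b_der2 Cf x z).
have [c _ ->] := MVT_segment yy' (fun z _ => C1b_der2 Cf x z) (continuous_subspaceT cf).
by rewrite normrM ler_wpM2r// (C1b_bound2 Cf).
Qed.

Let mQ : measurable_fun [set: RT] (Q : RT -> RT).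
Proof. exact: measurable_gap_inv. Qed.

Let bfs_slab (b : RT -> bool) (x a c : R) : measurable_fun [set: RT] b ->
  (forall t : R, b t -> a <= t <= c) -> bfs leb (fun t => (b t)%:R * f (x, Q t)).
Proof.
move=> mb bac; apply: (@bfs_itv _ _ a c B).
- apply: measurable_funM; first exact: measurable_natb.
  apply: measurableT_comp; first exact: C1b_meas Cf.
  by apply: measurable_fun_pair => //; exact: measurable_cst.
- move=> t; rewrite normrM (le_trans _ (C1b_bound Cf (x, Q t)))//.
  by rewrite ler_piMl// ger0_norm// lern1 leq_b1.
- by move=> t; case: (boolP (b t)) => [/bac//|]; rewrite mul0r eqxx.
Qed.

(** A strip is the difference of two corners with the same side x = [xl n i]. As [F] takes the value
    [xg n i] there, its level lines cross this side where [G] is between [yg n k] and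
    [yg n k + q n]. *)
Lemma strip_flux n i k : (i < 2 ^ n)%N ->
  flux (fun p => (strip n i k p)%:R) f1 f2 =
  \int[leb]_t ((yg n k < t < yg n k + q n)%R%:R * f (xl n i, Q t)).
Proof.
move=> i2; have bC := bfs2_corner mC1 C1_ge0 C1_le1 mC2 C2_le1.
have xl_ge0 : 0 <= xl n i by exact: cell_left_ge0.
have yg_ge0 : 0 <= yg n k by exact: cell_gap_ge0.
have Fxl : F (xl n i) = xg n i by exact: gap_length_cell.
have [bc1 bc1'] := bfs2_gap_flux mC1 mC2 Cf (bC (xg n i + yg n k + q n) (xl n i)).
have [bc2 bc2'] := bfs2_gap_flux mC1 mC2 Cf (bC (xg n i + yg n k) (xl n i)).
transitivity (flux (fun p => (corner C1 C2 (xg n i + yg n k + q n) (xl n i) p)%:R) f1 f2 -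
  flux (fun p => (corner C1 C2 (xg n i + yg n k) (xl n i) p)%:R) f1 f2).
  rewrite /gap_flux -bfs_RintegralB; last 2 first.
  - under eq_fun do rewrite mulrBr; apply: bfsB; exact: bfs2_bfs.
  - under eq_fun do rewrite mulrBr; apply: bfsB; exact: bfs2_bfs.
  by apply: eq_Rintegral => p _; rewrite -mulrBl -stripE.
rewrite !(corner_flux mC1 C1_ge0 C1_le1 mC2 C2_ge0 C2_le1 _ Cf f0y fx0)// Fxl.
have -> : xg n i + yg n k + q n - xg n i = yg n k + q n by ring.
have -> : xg n i + yg n k - xg n i = yg n k by ring.
have mo (a c : R) : measurable_fun [set: RT] (fun t : RT => (a < t) && (t < c)).
  by apply: measurable_and; exact: measurable_fun_ltr.
have bo (a c : R) : bfs leb (fun t => ((a < t) && (t < c))%:R * f (xl n i, Q t)).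
  by apply: (@bfs_slab _ _ a c) => // t /andP[/ltW-> /ltW->].
rewrite -bfs_RintegralB//; apply/eqP; rewrite -subr_eq0 -bfs_RintegralB//; last exact: bfsB.
(* The difference of the two half-line conditions contains the end point [yg n k], which the open
   interval omits. *)
apply/eqP; apply: (@Rintegral_ae1 _ _ (yg n k)) => t tyg.
rewrite -!mulrBl; apply/eqP; rewrite mulf_eq0; apply/orP; left.
have q0 := q_gt0 n; case: (ltgtP t (yg n k)) tyg => // tyg _.
  rewrite (lt_trans tyg) ?ltrDl//= andbT subrr.
  by rewrite subrr.
by rewrite andbF subr0 (le_lt_trans yg_ge0 tyg)/= subrr.
Qed.

(** [Q] maps the range of integration, of length [q n], into the cell [k] of [C2], and there [f]
    differs from its value at the left end by at most [B] times the length of the cell. *)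
Lemma strip_flux_approx n i k : (i < 2 ^ n)%N -> (k < 2 ^ n)%N ->
  `|flux (fun p => (strip n i k p)%:R) f1 f2 - q n * f (xl n i, yl n k)| <=
  q n * (B * cell_length 1 n).
Proof.
move=> i2 k2; rewrite strip_flux//.
have mo (a c : R) : measurable_fun [set: RT] (fun t : RT => (a < t) && (t < c)).
  by apply: measurable_and; exact: measurable_fun_ltr.
have bo (a c : R) : bfs leb (fun t => ((a < t) && (t < c))%:R * f (xl n i, Q t)).
  by apply: (@bfs_slab _ _ a c) => // t /andP[/ltW-> /ltW->].
have b1 : bfs leb (fun t : RT => (yg n k < t < yg n k + q n)%R%:R : R).
  apply: (@bfs_itv _ _ (yg n k) (yg n k + q n) 1).
  - exact: measurable_natb.
  - by move=> t; rewrite ger0_norm// lern1 leq_b1.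
  - by move=> t; case: (boolP (_ < t < _)) => [/andP[/ltW-> /ltW->]//|]; rewrite eqxx.
have qE : q n = \int[leb]_t (yg n k < t < yg n k + q n)%R%:R.
  transitivity (\int[leb]_t ((yg n k < t < yg n k + q n)%R%:R * 1)); last first.
    by apply: eq_Rintegral => t _; rewrite mulr1.
  rewrite (@Rintegral_natb _ _ `]yg n k, yg n k + q n[%classic); last first.
    by move=> t; rewrite mem_setE in_itv.
  have mi : measurable (`]yg n k, yg n k + q n[%classic : set RT).
    exact: measurable_itv.
  rewrite (Rintegral_cst _ mi).
  rewrite [X in fine X]lebesgue_measure_itv/= lte_fin ltrDl q_gt0/= mul1r; ring.
rewrite mulrC [X in _ <= X]mulrC {2 3}qE -!bfs_RintegralZ//.
rewrite -bfs_RintegralB//; last exact: bfsZ.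
apply: bfs_normr_Rintegral; [by apply: bfsB => //; exact: bfsZ|exact: bfsZ|].
move=> t; case: (boolP (_ < t < _)) => [/andP[t1 t2]|_]; last first.
  by rewrite mul0r !mulr0 subrr normr0.
rewrite mul1r !mulr1 (le_trans (C1_bounded_lip2 _ _ _))// ler_wpM2l//.
have h1 : yl n k < Q t by rewrite gap_inv_ltE// gap_length_cell.
have h2 : Q t <= yl n k + cell_length 1 n.
  by rewrite gap_inv_leE// gap_length_cell_right// mul1r ltW.
by rewrite ger0_norm; lra.
Qed.

Let Riemann_sum n : R :=
  \sum_(i < 2 ^ n) \sum_(k < 2 ^ n) q n * f (xl n i, yl n k).

Let sum_q n (c : R) : \sum_(i < 2 ^ n) \sum_(k < 2 ^ n) q n * c = c.
Proof.
have E : 4%:R ^+ n = ((2 ^ n * 2 ^ n)%:R : R) by rewrite -expnMn natrX.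
under eq_bigr do rewrite sumr_const card_ord.
rewrite sumr_const card_ord -mulrnA -[LHS]mulr_natl -E mulrA -exprMn divff// expr1n.
by rewrite mul1r.
Qed.

Lemma upstream_flux_approx n :
  `|flux (upstream_ n) f1 f2 - Riemann_sum n| <= B * cell_length 1 n.
Proof.
have bfl s : bfs2 leb leb s -> bfs (leb \x leb)%E
    (fun p => s p * (\1_(~` C2) p.2 * f1 p - \1_(~` C1) p.1 * f2 p)).
  move=> bs; have [b1 b2] := bfs2_gap_flux mC1 mC2 Cf bs.
  by under eq_fun do rewrite mulrBr; apply: bfsB; exact: bfs2_bfs.
have -> : flux (upstream_ n) f1 f2 =
    \sum_(i < 2 ^ n) \sum_(k < 2 ^ n) flux (fun p => (strip n i k p)%:R) f1 f2.
  rewrite /gap_flux; under [RHS]eq_bigr do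
    (rewrite -bfs_Rintegral_sum; last by move=> k; exact: bfl (bfs2_strip _ _ _)).
  rewrite -bfs_Rintegral_sum; last first.
    by move=> i; apply: bfs_sum => k; exact: bfl (bfs2_strip _ _ _).
  apply: eq_Rintegral => p _; rewrite /upstream_ mulr_suml; apply: eq_bigr => i _.
  by rewrite mulr_suml.
rewrite /Riemann_sum -sumrB (le_trans (ler_norm_sum _ _ _))//.
rewrite -[leRHS](sum_q n); apply: ler_sum => i _.
rewrite -sumrB (le_trans (ler_norm_sum _ _ _))//; apply: ler_sum => k _.
exact: strip_flux_approx.
Qed.

Let inner (x : R) : R := \int[leb]_y (\1_C2 y * f (x, y)).

Let bfs_inner (x : R) : bfs leb (fun y => \1_C2 y * f (x, y)).
Proof.
under eq_fun do rewrite mulrC; apply: bfsMl.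
- by apply: measurable_fun_pair2; exact: C1b_meas Cf.
- by exists B => y; exact: C1b_bound Cf _.
- by apply: bfs_indic => //; exact: gap_mass_fin.
Qed.

Let bfs_C2 : bfs leb (\1_C2 : RT -> R).
Proof. by apply: bfs_indic => //; exact: gap_mass_fin. Qed.

Let bfs_C1 : bfs leb (\1_C1 : RT -> R).
Proof. by apply: bfs_indic => //; exact: gap_mass_fin. Qed.

Let int_C2 : \int[leb]_y (\1_C2 y : R) = 1.
Proof. by rewrite Rintegral_indic// [X in fine X]leb_fat_cantor. Qed.

Let inner_bound x : `|inner x| <= B.
Proof.
rewrite -[leRHS]mulr1 -int_C2 -bfs_RintegralZ//.
apply: bfs_normr_Rintegral => //; first exact: bfsZ.
move=> y; rewrite normrM [X in X * _]ger0_norm// mulrC ler_wpM2r//.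
exact: C1b_bound Cf _.
Qed.

Let inner_lip x x' : `|inner x - inner x'| <= B * `|x - x'|.
Proof.
rewrite -[leRHS]mulr1 -int_C2 -bfs_RintegralZ// -bfs_RintegralB//.
apply: bfs_normr_Rintegral; [exact: bfsB|exact: bfsZ|].
move=> y; rewrite -mulrBr normrM [X in X * _]ger0_norm// mulrC ler_wpM2r//.
exact: C1_bounded_lip1.
Qed.

Let measurable_inner : measurable_fun [set: RT] inner.
Proof.
apply: continuous_measurable_fun => x; apply/cvgrPdist_lt => e e0.
near=> x'; rewrite (le_lt_trans (inner_lip _ _))//.
(* [B] may be 0, hence the division by [B + 1]. *)
rewrite (@le_lt_trans _ _ ((B + 1) * `|x - x'|))// ?ler_wpM2r ?lerDl//.
rewrite mulrC -ltr_pdivlMr ?ltr_wpDl//; near: x'.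
by apply/nbhs_ballP; exists (e / (B + 1)) => //=; rewrite divr_gt0// ltr_wpDl.
Unshelve. all: by end_near. Qed.

(** Since 4^-n = 2^-n 2^-n, the double sum is a Riemann sum over [C2] for each left end [xl n i],
    followed by one over [C1] for the inner integral, which inherits the Lipschitz constant [B] in
    x. *)
Lemma Riemann_sum_approx n :
  `|\int[leb]_x (\1_C1 x * inner x) - Riemann_sum n| <=
  B * cell_length 2 n + B * cell_length 1 n.
Proof.
have h1 := fat_cantor_Riemann lam2 n measurable_inner (ex_intro _ B inner_bound) inner_lip.
rewrite (le_trans (ler_distD (\sum_(i < 2 ^ n) 2^-1 ^+ n * inner (xl n i)) _ _))//.
apply: lerD => //.
have E : 2%:R ^+ n = ((2 ^ n)%:R : R) by rewrite natrX.
have -> : B * cell_length 1 n = \sum_(i < 2 ^ n) 2^-1 ^+ n * (B * cell_length 1 n).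
  rewrite sumr_const card_ord -[RHS]mulr_natl -E mulrA -exprMn divff// expr1n.
  by rewrite mul1r.
rewrite /Riemann_sum -sumrB (le_trans (ler_norm_sum _ _ _))//.
apply: ler_sum => i _.
have h2 : `|inner (xl n i) - \sum_(k < 2 ^ n) 2^-1 ^+ n * f (xl n i, yl n k)| <=
    B * cell_length 1 n.
  apply: (fat_cantor_Riemann lam1 n).
  - by apply: measurable_fun_pair2; exact: C1b_meas Cf.
  - by exists B => y; exact: C1b_bound Cf _.
  - by move=> y y'; exact: C1_bounded_lip2.
have -> : \sum_(k < 2 ^ n) q n * f (xl n i, yl n k) =
    2^-1 ^+ n * \sum_(k < 2 ^ n) 2^-1 ^+ n * f (xl n i, yl n k).
  rewrite mulr_sumr; apply: eq_bigr => k _; rewrite mulrA -exprMn; congr (_ ^+ _ * _).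
  by field.
by rewrite -mulrBr normrM ger0_norm// ler_wpM2l.
Qed.

(** The fluxes of the stages tend to the left-hand side by dominated convergence, and to the
    right-hand side because both are close to the same Riemann sums. *)
Lemma upstream_flux : flux upstream f1 f2 =
  \int[leb]_x (\1_C1 x * \int[leb]_y (\1_C2 y * f (x, y))).
Proof.
have c1 : flux (upstream_ n) f1 f2 @[n --> \oo] --> flux upstream f1 f2.
  pose g p := \1_(~` C2) p.2 * f1 p - \1_(~` C1) p.1 * f2 p.
  have bC := bfs2_corner mC1 C1_ge0 C1_le1 mC2 C2_le1 1 2.
  have mg : measurable_fun [set: RT * RT] g.
    apply: measurable_funB; apply: measurable_funM.
    - by apply: measurableT_comp measurable_snd; apply: measurable_indic; exact: measurableC.
    - exact: C1b_meas1 Cf.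
    - by apply: measurableT_comp measurable_fst; apply: measurable_indic; exact: measurableC.
    - exact: C1b_meas2 Cf.
  have gB p : `|g p| <= B + B.
    have i1 (C : set RT) z : `|\1_C z : R| <= 1 by rewrite indicE ger0_norm// lern1 leq_b1.
    rewrite (le_trans (ler_normB _ _))// lerD// normrM.
      by rewrite (le_trans _ (C1b_bound1 Cf p))// ler_piMl.
    by rewrite (le_trans _ (C1b_bound2 Cf p))// ler_piMl.
  apply: (proj2 (@bfs_cvg _ _ _ (leb \x leb)%E (fun n p => upstream_ n p * g p)
    (fun p => upstream p * g p) (fun p => (B + B) * (corner C1 C2 1 2 p)%:R) _ _ _ _)).
  - by move=> n; apply: measurable_funM => //; exact: measurable_upstream_.
  - by move=> p; apply: cvgMl; exact: upstream_cvg.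
  - by apply: bfsZ; exact: bfs2_bfs.
  - move=> n p; rewrite normrM mulrC ler_pM//.
    by rewrite ger0_norm ?upstream_ge0_// upstream_le_.
have c2 : flux (upstream_ n) f1 f2 @[n --> \oo] --> \int[leb]_x (\1_C1 x * inner x).
  apply/cvgrPdist_le => e e0.
  have ct (l : R) : cell_length l n @[n --> \oo] --> (0 : R).
    rewrite -[X in _ --> X]addr0; apply: cvgD.
      by apply: cvg_expr; rewrite ger0_norm ?invr_ge0// invf_lt1// ltr1n.
    rewrite -[X in _ --> X](mulr0 l); apply: cvgMr.
    by apply: cvg_expr; rewrite ger0_norm ?invr_ge0// invf_lt1// ltr1n.
  have c0 : B * cell_length 2 n + B * cell_length 1 n + B * cell_length 1 n
      @[n --> \oo] --> (0 : R).
    rewrite -[X in _ --> X]addr0 -[X in _ --> X + _]addr0 -[X in _ --> X + _ + _](mulr0 B).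
    rewrite -[X in _ --> _ + X + _](mulr0 B) -[X in _ --> _ + _ + X](mulr0 B).
    by apply: cvgD; [apply: cvgD|]; apply: cvgMr; exact: ct.
  move/cvgr0Pnorm_le : c0 => /(_ e e0); apply: filterS => n hn.
  rewrite (le_trans (ler_distD (Riemann_sum n) _ _))//.
  rewrite (le_trans _ hn)// (le_trans _ (ler_norm _))// lerD//.
    exact: Riemann_sum_approx.
  by rewrite distrC; exact: upstream_flux_approx.
by rewrite -(cvg_lim _ c1)// (cvg_lim _ c2).
Qed.

End flux_limit.
End upstream.

(** * Reflection to a field on the plane with closed flow lines *)

Section fold.
Variable R : realType.
Notation leb := (@lebesgue_measure R).
Notation RT := (measurableTypeR R).
Implicit Types (g s : RT * RT -> R) (p : RT * RT).

Definition flip1 p : RT * RT := (- p.1, p.2).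
Definition flip2 p : RT * RT := (p.1, - p.2).
Definition abs2 p : RT * RT := (`|p.1|, `|p.2|).

Let quad p : bool := (0 < p.1) && (0 < p.2).

Lemma measurable_flip1 : measurable_fun [set: RT * RT] flip1.
Proof.
apply: measurable_fun_pair => //.
by apply: measurableT_comp measurable_fst; exact: oppr_measurable.
Qed.

Lemma measurable_flip2 : measurable_fun [set: RT * RT] flip2.
Proof.
apply: measurable_fun_pair => //.
by apply: measurableT_comp measurable_snd; exact: oppr_measurable.
Qed.

Lemma measurable_abs2 : measurable_fun [set: RT * RT] abs2.
Proof.
apply: measurable_fun_pair.
  by apply: measurableT_comp measurable_fst; exact: normr_measurable.
by apply: measurableT_comp measurable_snd; exact: normr_measurable.
Qed.

Lemma bfs2_flip1 g : bfs2 leb leb g -> bfs2 leb leb (g \o flip1).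
Proof.
move=> [mg [D1 [D2 [M [[mD1 D1f] D2f gM]]]]]; split.
  exact: measurableT_comp measurable_flip1.
have [] : bfs leb ((\1_D1 : RT -> R) \o (fun x => 0 - x)).
  by apply: bfs_reflection; exact: bfs_indic.
move=> _ [D [N [mD Df DN]]]; exists D, D2, (`|M| * N); split => // p /=.
rewrite (le_trans (gM _))//= (le_trans (ler_wpM2r _ (ler_norm M)))// -!mulrA ler_wpM2l//.
rewrite mulrA ler_wpM2r// -[leLHS]ger0_norm//.
by have := DN p.1; rewrite /= sub0r.
Qed.

Lemma bfs2_flip2 g : bfs2 leb leb g -> bfs2 leb leb (g \o flip2).
Proof.
move=> [mg [D1 [D2 [M [D1f [mD2 D2f] gM]]]]]; split.
  exact: measurableT_comp measurable_flip2.
have [] : bfs leb ((\1_D2 : RT -> R) \o (fun x => 0 - x)).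
  by apply: bfs_reflection; exact: bfs_indic.
move=> _ [D [N [mD Df DN]]]; exists D1, D, (`|M| * N); split => // p /=.
rewrite (le_trans (gM _))//= (le_trans (ler_wpM2r _ (ler_norm M)))// -!mulrA ler_wpM2l//.
rewrite mulrCA ler_wpM2l// -[leLHS]ger0_norm//.
by have := DN p.2; rewrite /= sub0r.
Qed.

Lemma Rintegral_flip1 g : bfs2 leb leb g ->
  \int[(leb \x leb)%E]_p g (flip1 p) = \int[(leb \x leb)%E]_p g p.
Proof.
move=> bg; rewrite (bfs2_Fubini1 bg) (bfs2_Fubini1 (bfs2_flip1 bg)).
apply: eq_Rintegral => y _; rewrite -(lebesgue_reflection 0 (bfs2_slice1 y bg)).
by apply: eq_Rintegral => x _; rewrite /flip1/= sub0r.
Qed.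

Lemma Rintegral_flip2 g : bfs2 leb leb g ->
  \int[(leb \x leb)%E]_p g (flip2 p) = \int[(leb \x leb)%E]_p g p.
Proof.
move=> bg; rewrite (bfs2_Fubini2 bg) (bfs2_Fubini2 (bfs2_flip2 bg)).
apply: eq_Rintegral => x _; rewrite -(lebesgue_reflection 0 (bfs2_slice2 x bg)).
by apply: eq_Rintegral => y _; rewrite /flip2/= sub0r.
Qed.

(** The reflections of the open first quadrant cover the plane up to the axes, where [g]
    vanishes. *)
Lemma Rintegral_fold g : bfs2 leb leb g ->
    (forall y : R, g (0, y) = 0) -> (forall x : R, g (x, 0) = 0) ->
  \int[(leb \x leb)%E]_p g p =
  \int[(leb \x leb)%E]_p (((0 < p.1) && (0 < p.2))%:R *
    (g p + g (flip1 p) + (g (flip2 p) + g (flip1 (flip2 p))))).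
Proof.
move=> bg g0y gx0.
have mq : measurable_fun [set: RT * RT] (fun p => (quad p)%:R : R).
  by apply: measurable_natb; apply: measurable_and; exact: measurable_fun_ltr.
have bq h : bfs2 leb leb h -> bfs2 leb leb (fun p => (quad p)%:R * h p).
  by apply: bfs2Ml => //; exists 1 => p; rewrite ger0_norm// lern1 leq_b1.
have b1 := bq _ bg.
have b2 := bq _ (bfs2_flip1 bg).
have b3 := bq _ (bfs2_flip2 bg).
have b4 := bq _ (bfs2_flip2 (bfs2_flip1 bg)).
have b2' := bfs2_flip1 b2; have b3' := bfs2_flip2 b3.
have b4' := bfs2_flip2 (bfs2_flip1 b4).
transitivity (\int[(leb \x leb)%E]_p (((quad p)%:R * g p) + ((quad p)%:R * g (flip1 p)) +
    ((quad p)%:R * g (flip2 p) + (quad p)%:R * g (flip1 (flip2 p))))); last first.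
  by apply: eq_Rintegral => p _; rewrite -!mulrDr.
have B h : bfs2 leb leb h -> bfs (leb \x leb)%E h by exact: bfs2_bfs.
rewrite bfs_RintegralD; [|by apply: bfsD; exact: B|by apply: bfsD; exact: B].
rewrite bfs_RintegralD; [|exact: B|exact: B].
rewrite [X in _ + X]bfs_RintegralD; [|exact: B|exact: B].
rewrite -(Rintegral_flip1 b2) -(Rintegral_flip2 b3).
rewrite -(Rintegral_flip1 b4) -(Rintegral_flip2 (bfs2_flip1 b4)).
rewrite -!bfs_RintegralD;
  [|solve [exact: (B _ b1)|exact: (B _ b2')|exact: (B _ b3')|exact: (B _ b4')
    |exact: (bfsD (B _ b1) (B _ b2'))|exact: (bfsD (B _ b3') (B _ b4'))]..].
apply: eq_Rintegral => -[x y] _; rewrite /quad /flip1 /flip2/= !opprK !oppr_gt0.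
case: (ltgtP x 0) => [x0|x0|->]; rewrite ?g0y.
- by case: (ltgtP y 0) => y0; rewrite /= ?mul0r ?mul1r ?addr0 ?add0r// y0 gx0.
- by case: (ltgtP y 0) => y0; rewrite /= ?mul0r ?mul1r ?addr0 ?add0r// y0 gx0.
- by rewrite !mul0r !addr0.
Qed.

Local Notation C1 := (@fat_cantor R 2).
Local Notation C2 := (@fat_cantor R 1).

(** The integrand s v . grad f on the whole plane, with [s] made even; the signs are the derivatives
    of |x| and |y| in the stream function. *)
Definition folded_flux s f1 f2 p : R := s (abs2 p) *
  (Num.sg p.2 * \1_(~` C2) `|p.2| * f1 p - Num.sg p.1 * \1_(~` C1) `|p.1| * f2 p).

(** The field runs clockwise, and the part of a level line kept is the one around the y-axis. Hence
    the flow stops on the dust in the first and third quadrants, where the sign is positive, and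
    starts on it in the other two. *)
Definition sink p : R :=
  Num.sg p.1 * Num.sg p.2 * (\1_C1 `|p.1| * \1_C2 `|p.2|).

(* [folded_flux] and [sink] are integrated over the open first quadrant, where
   the four reflections turn the test function into its odd part; the latter
   vanishes on the axes, as required by [corner_flux]. *)
Definition odd_part f p : R :=
  f p - f (flip1 p) - (f (flip2 p) - f (flip1 (flip2 p))).

Definition odd_part1 f1 p : R :=
  f1 p + f1 (flip1 p) - (f1 (flip2 p) + f1 (flip1 (flip2 p))).

Definition odd_part2 f2 p : R :=
  f2 p - f2 (flip1 p) + (f2 (flip2 p) - f2 (flip1 (flip2 p))).

Lemma C1_bounded_odd_part B f f1 f2 : C1_bounded B f f1 f2 ->
  C1_bounded (4 * B) (odd_part f) (odd_part1 f1) (odd_part2 f2).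
Proof.
move=> [m m1 m2 d1 d2 c1 c2 b b1 b2].
have mf1 (h : RT * RT -> R) : measurable_fun [set: RT * RT] h ->
  measurable_fun [set: RT * RT] (fun p => h (flip1 p)).
  by move=> mh; exact: measurableT_comp measurable_flip1.
have mf2 (h : RT * RT -> R) : measurable_fun [set: RT * RT] h ->
  measurable_fun [set: RT * RT] (fun p => h (flip2 p)).
  by move=> mh; exact: measurableT_comp measurable_flip2.
have mf12 (h : RT * RT -> R) : measurable_fun [set: RT * RT] h ->
  measurable_fun [set: RT * RT] (fun p => h (flip1 (flip2 p))).
  by move=> mh; apply: (mf2 (fun p => h (flip1 p))); exact: mf1.
have d1n x y : is_derive x (1 : R) (fun t : R => f (- t, y)) (- f1 (- x, y)).
  have := @is_derive1_comp R (fun t : R => f (t, y)) -%R x (f1 (- x, y)) (-1).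
  by rewrite /comp mulrN1; apply.
have d2n x y : is_derive y (1 : R) (fun t : R => f (x, - t)) (- f2 (x, - y)).
  have := @is_derive1_comp R (fun t : R => f (x, t)) -%R y (f2 (x, - y)) (-1).
  by rewrite /comp mulrN1; apply.
split.
- apply: measurable_funB; apply: measurable_funB => //; [exact: mf1|exact: mf2|exact: mf12].
- apply: measurable_funB; apply: measurable_funD => //; [exact: mf1|exact: mf2|exact: mf12].
- apply: measurable_funD; apply: measurable_funB => //; [exact: mf1|exact: mf2|exact: mf12].
- move=> x y; rewrite /odd_part /odd_part1 /flip1 /flip2/=.
  apply: is_deriveB; last first.
    have -> : f1 (x, - y) + f1 (- x, - y) = f1 (x, - y) - - f1 (- x, - y) by rewrite opprK.
    by apply: is_deriveB.
  have -> : f1 (x, y) + f1 (- x, y) = f1 (x, y) - - f1 (- x, y) by rewrite opprK.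
  by apply: is_deriveB.
- move=> x y; rewrite /odd_part /odd_part2 /flip1 /flip2/=.
  have -> : f2 (x, y) - f2 (- x, y) + (f2 (x, - y) - f2 (- x, - y)) =
     f2 (x, y) - f2 (- x, y) - (- f2 (x, - y) - - f2 (- x, - y)) by ring.
  by apply: is_deriveB; apply: is_deriveB.
- move=> y x; rewrite /odd_part1 /flip1 /flip2/=.
  have cN z : {for x, continuous (fun t : R => f1 (- t, z))}.
    by apply: (@continuous_comp _ _ _ (fun t : R => - t) (fun t => f1 (t, z)));
      [exact: opp_continuous|exact: c1].
  by apply: cvgB; apply: cvgD; [exact: c1|exact: cN|exact: c1|exact: cN].
- move=> x y; rewrite /odd_part2 /flip1 /flip2/=.
  have cN z : {for y, continuous (fun t : R => f2 (z, - t))}.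
    by apply: (@continuous_comp _ _ _ (fun t : R => - t) (fun t => f2 (z, t)));
      [exact: opp_continuous|exact: c2].
  by apply: cvgD; apply: cvgB; [exact: c2|exact: c2|exact: cN|exact: cN].
- move=> p; rewrite /odd_part (le_trans (ler_normB _ _))//.
  rewrite (le_trans (lerD (ler_normB _ _) (ler_normB _ _)))//.
  have := b p; have := b (flip1 p); have := b (flip2 p); have := b (flip1 (flip2 p)).
  lra.
- move=> p; rewrite /odd_part1 (le_trans (ler_normB _ _))//.
  rewrite (le_trans (lerD (ler_normD _ _) (ler_normD _ _)))//.
  have := b1 p; have := b1 (flip1 p); have := b1 (flip2 p); have := b1 (flip1 (flip2 p)).
  lra.
- move=> p; rewrite /odd_part2 (le_trans (ler_normD _ _))//.
  rewrite (le_trans (lerD (ler_normB _ _) (ler_normB _ _)))//.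
  have := b2 p; have := b2 (flip1 p); have := b2 (flip2 p); have := b2 (flip1 (flip2 p)).
  lra.
Qed.

Lemma odd_part0y f (y : R) : odd_part f (0, y) = 0.
Proof. by rewrite /odd_part /flip1 /flip2/= oppr0 !subrr. Qed.

Lemma odd_partx0 f (x : R) : odd_part f (x, 0) = 0.
Proof. by rewrite /odd_part /flip1 /flip2/= oppr0 subrr. Qed.

Lemma measurable_sgr : measurable_fun [set: RT] (Num.sg : RT -> RT).
Proof.
apply: nondecreasing_measurable => // x y xy.
have [y0|y0|y0] := ltgtP y 0.
- by rewrite (ltr0_sg y0) (ltr0_sg (le_lt_trans xy y0)).
- by rewrite (gtr0_sg y0) (le_trans (ler_norm _))// normr_sg lern1 leq_b1.
- rewrite y0 sgr0; have := xy; rewrite y0 le_eqVlt => /predU1P[->|x0]; first by rewrite sgr0.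
  by rewrite (ltr0_sg x0) lerN10.
Qed.

Let measurable_folded (f1 f2 : RT * RT -> R) : measurable_fun [set: RT * RT] f1 ->
  measurable_fun [set: RT * RT] f2 -> measurable_fun [set: RT * RT] (fun p : RT * RT =>
  Num.sg p.2 * \1_(~` C2) `|p.2| * f1 p - Num.sg p.1 * \1_(~` C1) `|p.1| * f2 p : R).
Proof.
move=> m1 m2.
have i1 : measurable_fun [set: RT] (fun x : RT => \1_(~` C1) `|x| : R).
  apply: measurableT_comp; last exact: normr_measurable.
  by apply: measurable_indic; apply: measurableC; exact: measurable_fat_cantor.
have i2 : measurable_fun [set: RT] (fun x : RT => \1_(~` C2) `|x| : R).
  apply: measurableT_comp; last exact: normr_measurable.
  by apply: measurable_indic; apply: measurableC; exact: measurable_fat_cantor.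
apply: measurable_funB; apply: measurable_funM => //; apply: measurable_funM.
- by apply: measurableT_comp measurable_snd; exact: measurable_sgr.
- exact: (measurableT_comp i2 measurable_snd).
- by apply: measurableT_comp measurable_fst; exact: measurable_sgr.
- exact: (measurableT_comp i1 measurable_fst).
Qed.

(** The value at [abs2 p] is one of the values of [s] at the four reflections of [p], hence bounded
    by the sum of their absolute values. *)
Lemma bfs2_abs2 s : bfs2 leb leb s -> bfs2 leb leb (s \o abs2).
Proof.
move=> bs; apply: (@bfs2_le _ _ _ _ _ leb leb (fun p => `|s p| + `|s (flip1 p)| +
    (`|s (flip2 p)| + `|s (flip1 (flip2 p))|))).
- by apply: measurableT_comp measurable_abs2; case: bs.
- exists 1 => -[x y]; rewrite mul1r [leRHS]ger0_norm ?addr_ge0//= /abs2 /flip1 /flip2/=.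
  have h := (normr_ge0 (s (x, y)), normr_ge0 (s (- x, y)),
    (normr_ge0 (s (x, - y)), normr_ge0 (s (- x, - y)))).
  case: h => -[h1 h2] [h3 h4].
  by case: (ger0P x) => _; case: (ger0P y) => _; lra.
- have n g : bfs2 leb leb g -> bfs2 leb leb (fun p => `|g p|).
    move=> bg; apply: (bfs2_le _ _ bg).
      by apply: measurableT_comp; [exact: normr_measurable|case: bg].
    by exists 1 => p; rewrite mul1r normr_id.
  by apply: bfs2D; apply: bfs2D; apply: n => //;
    [exact: bfs2_flip1|exact: bfs2_flip2|exact: bfs2_flip2 (bfs2_flip1 bs)].
Qed.

Lemma bfs2_folded_flux B s f f1 f2 : C1_bounded B f f1 f2 -> bfs2 leb leb s ->
  bfs2 leb leb (folded_flux s f1 f2).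
Proof.
move=> Cf bs; rewrite /folded_flux; under eq_fun do rewrite mulrC.
apply: bfs2Ml (bfs2_abs2 bs).
  by apply: measurable_folded; [exact: C1b_meas1 Cf|exact: C1b_meas2 Cf].
exists (B + B) => p; rewrite (le_trans (ler_normB _ _))// lerD// normrM.
  rewrite (le_trans _ (C1b_bound1 Cf p))// ler_piMl// normrM indicE.
  by rewrite normr_sg normr_nat mulr_ile1 ?lern1 ?leq_b1.
rewrite (le_trans _ (C1b_bound2 Cf p))// ler_piMl// normrM indicE.
by rewrite normr_sg normr_nat mulr_ile1 ?lern1 ?leq_b1.
Qed.

Lemma Rintegral_folded_flux B s f f1 f2 : C1_bounded B f f1 f2 -> bfs2 leb leb s ->
    (forall p, s p != 0 -> 0 < p.1 /\ 0 < p.2) ->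
  \int[(leb \x leb)%E]_p folded_flux s f1 f2 p =
  gap_flux C1 C2 s (odd_part1 f1) (odd_part2 f2).
Proof.
move=> Cf bs s0; rewrite (Rintegral_fold (bfs2_folded_flux Cf bs)); last 2 first.
- move=> y; rewrite /folded_flux /abs2/= normr0.
  case: (eqVneq (s (0, `|y|)) 0) => [->|/s0[]/=]; first by rewrite mul0r.
  by rewrite ltxx.
- move=> x; rewrite /folded_flux /abs2/= normr0.
  case: (eqVneq (s (`|x|, 0)) 0) => [->|/s0[]/=]; first by rewrite mul0r.
  by rewrite ltxx.
apply: eq_Rintegral => -[x y] _; rewrite /folded_flux /flip1 /flip2 /abs2/=.
rewrite !normrN !sgrN; have [x0|x0] := ltP 0 x; last first.
  rewrite mul0r; case: (eqVneq (s (x, y)) 0) => [->|/s0[]/=]; first by rewrite mul0r.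
  by rewrite ltNge x0.
have [y0|y0] := ltP 0 y; last first.
  rewrite mul0r; case: (eqVneq (s (x, y)) 0) => [->|/s0[]/= _]; first by rewrite mul0r.
  by rewrite ltNge y0.
rewrite !gtr0_norm// !gtr0_sg// /odd_part1 /odd_part2 /flip1 /flip2/=.
ring.
Qed.

Lemma bfs2_sink : bfs2 leb leb sink.
Proof.
have bC (l : R) : 0 < l -> bfs leb (\1_(fat_cantor l) : RT -> R).
  move=> l0; apply: bfs_indic; first exact: measurable_fat_cantor.
  by rewrite [X in (X < _)%E]leb_fat_cantor// ltry.
have l2 : (0 : R) < 2 by []; have l1 : (0 : R) < 1 by [].
have := bfs2_abs2 (bfs2_prod (bC _ l2) (bC _ l1)).
apply: bfs2Ml.
  apply: measurable_funM.
    by apply: measurableT_comp measurable_fst; exact: measurable_sgr.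
  by apply: measurableT_comp measurable_snd; exact: measurable_sgr.
by exists 1 => p; rewrite normrM !normr_sg mulr_ile1 ?lern1 ?leq_b1.
Qed.

Lemma Rintegral_sink B f f1 f2 : C1_bounded B f f1 f2 ->
  \int[(leb \x leb)%E]_p (sink p * f p) =
  \int[leb]_x (\1_C1 x * \int[leb]_y (\1_C2 y * odd_part f (x, y))).
Proof.
move=> Cf.
have bC (l : R) : 0 < l -> bfs leb (\1_(fat_cantor l) : RT -> R).
  move=> l0; apply: bfs_indic; first exact: measurable_fat_cantor.
  by rewrite [X in (X < _)%E]leb_fat_cantor// ltry.
have l2 : (0 : R) < 2 by []; have l1 : (0 : R) < 1 by [].
have bs : bfs2 leb leb (fun p => sink p * f p).
  under eq_fun do rewrite mulrC; apply: bfs2Ml bfs2_sink; first exact: C1b_meas Cf.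
  by exists B; exact: C1b_bound Cf.
have Co := C1_bounded_odd_part Cf.
have bo : bfs2 leb leb (fun p => \1_C1 p.1 * \1_C2 p.2 * odd_part f p).
  under eq_fun do rewrite mulrC; apply: bfs2Ml (bfs2_prod (bC _ l2) (bC _ l1)).
    exact: C1b_meas Co.
  by exists (4 * B); exact: C1b_bound Co.
have bo2 x : bfs leb (fun y => \1_C2 y * odd_part f (x, y)).
  under eq_fun do rewrite mulrC; apply: bfsMl (bC _ l1).
    by apply: measurable_fun_pair2; exact: C1b_meas Co.
  by exists (4 * B) => y; exact: C1b_bound Co _.
rewrite (Rintegral_fold bs); last 2 first.
- by move=> y; rewrite /sink/= sgr0 !mul0r.
- by move=> x; rewrite /sink/= sgr0 mulr0 !mul0r.
transitivity (\int[(leb \x leb)%E]_p (\1_C1 p.1 * \1_C2 p.2 * odd_part f p)).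
  apply: eq_Rintegral => -[x y] _; rewrite /sink /flip1 /flip2/= !normrN !sgrN.
  have [x0|x0] := ltP 0 x; last first.
    rewrite mul0r [X in _ = X * _ * _]indicE memNset ?mul0r//.
    by move=> /fat_cantor_gt0; rewrite ltNge x0.
  have [y0|y0] := ltP 0 y; last first.
    rewrite mul0r [X in _ = _ * X * _]indicE memNset ?mulr0 ?mul0r//.
    by move=> /fat_cantor_gt0; rewrite ltNge y0.
  rewrite !gtr0_norm// !gtr0_sg// /odd_part /flip1 /flip2/=; ring.
rewrite (bfs2_Fubini2 bo); apply: eq_Rintegral => x _.
by rewrite -bfs_RintegralZ//; apply: eq_Rintegral => y _; rewrite mulrA.
Qed.

Lemma folded_flux_corner B f f1 f2 : C1_bounded B f f1 f2 ->
  \int[(leb \x leb)%E]_p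
    folded_flux (fun p => (corner C1 C2 1 2 p)%:R) f1 f2 p = 0.
Proof.
move=> Cf; rewrite (Rintegral_folded_flux Cf).
- exact: corner_flux0 (C1_bounded_odd_part Cf) (@odd_part0y _) (@odd_partx0 _).
- exact: bfs2_corner12.
- move=> p; case: (boolP (corner _ _ _ _ p)) => [/and4P[]//|]; by rewrite eqxx.
Qed.

(** The weak form, in the plane, of div (u v) = - w. *)
Lemma folded_flux_upstream B f f1 f2 : C1_bounded B f f1 f2 ->
  \int[(leb \x leb)%E]_p folded_flux (@upstream R) f1 f2 p =
  \int[(leb \x leb)%E]_p (sink p * f p).
Proof.
move=> Cf; rewrite (Rintegral_folded_flux Cf).
- rewrite (upstream_flux (C1_bounded_odd_part Cf) (@odd_part0y _) (@odd_partx0 _)).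
  by rewrite (Rintegral_sink Cf).
- exact: bfs2_upstream.
- move=> p up; have := upstream_le p; have := upstream_ge0 p.
  case: (boolP (corner _ _ _ _ p)) => [/and4P[]//|_ h1 h2].
  by move: up; rewrite (@le_anti _ _ (upstream p) 0) ?eqxx// h1 h2.
Qed.

End fold.

(** * Integration on row vectors *)

Section row_vectors.
Variable R : realType.
Notation leb := (@lebesgue_measure R).
Notation RT := (measurableTypeR R).

Lemma rV_cons0 n (p : RT * 'rV[R]_n) : rV_cons p ord0 ord0 = p.1.
Proof.
have -> : (ord0 : 'I_n.+1) = lshift n (ord0 : 'I_1) by exact/val_inj.
by apply: etrans (row_mxEl _ _ _ _) _; rewrite mxE.
Qed.

Lemma rV_consS n (p : RT * 'rV[R]_n) i : rV_cons p ord0 (lift ord0 i) = p.2 ord0 i.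
Proof.
have -> : (lift ord0 i : 'I_n.+1) = @rshift 1 n i by exact/val_inj.
exact: row_mxEr.
Qed.

Definition rV_box n (A : 'I_n -> set RT) : set 'rV[R]_n :=
  [set x | forall i, A i (x ord0 i)].

Lemma measurable_rV_box n (A : 'I_n -> set RT) :
  (forall i, measurable (A i)) -> measurable (rV_box A).
Proof.
move=> mA; rewrite (_ : rV_box A = \bigcap_(i in [set: 'I_n])
    ((fun x : 'rV[R]_n => x ord0 i : RT) @^-1` A i)).
  apply: fin_bigcap_measurable => // i _.
  by have := measurable_rV_coor i measurableT (mA i); rewrite setTI.
by apply/seteqP; split=> x /= h i; [move=> _; exact: h|exact: h].
Qed.

Lemma lebesgue_rV_box_fin n (A : 'I_n -> set RT) :
  (forall i, measurable (A i) /\ (leb (A i) < +oo)%E) ->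
  (lebesgue_rV R n (rV_box A) < +oo)%E.
Proof.
move=> mA; rewrite [X in (X < _)%E]lebesgue_rV_box; last by move=> i; case: (mA i).
rewrite -ge0_fin_numE; last by apply: prode_ge0 => i.
by apply: prode_fin_num => i _; rewrite ge0_fin_numE//; case: (mA i).
Qed.

(* A class stable under integration in the first coordinate. *)
Definition boxed n (f : 'rV[R]_n -> R) : Prop :=
  measurable_fun [set: 'rV[R]_n] f /\
  exists (A : 'I_n -> set RT) (M : R),
    (forall i, measurable (A i) /\ (leb (A i) < +oo)%E) /\
    forall x, `|f x| <= M * \1_(rV_box A) x.

Lemma boxed_bfs n (f : 'rV[R]_n -> R) : boxed f -> bfs (lebesgue_rV R n) f.
Proof.
move=> [mf [A [M [mA fM]]]]; split => //; exists (rV_box A), M; split => //.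
  by apply: measurable_rV_box => i; case: (mA i).
exact: lebesgue_rV_box_fin.
Qed.

Lemma indic_rV_box_cons n (A : 'I_n.+1 -> set RT) (p : RT * 'rV[R]_n) :
  \1_(rV_box A) (rV_cons p) =
  \1_(A ord0) p.1 * \1_(rV_box (fun i => A (lift ord0 i))) p.2 :> R.
Proof.
rewrite !indicE -natrM mulnb; congr (nat_of_bool _)%:R.
apply/idP/andP; rewrite !inE.
  move=> h; split; first by have := h ord0; rewrite rV_cons0.
  by move=> i; have := h (lift ord0 i); rewrite rV_consS.
move=> [h0 hS] i; case: (unliftP ord0 i) => [j ->|->].
  by rewrite rV_consS; exact: hS.
by rewrite rV_cons0.
Qed.

Lemma boxed_cons n (f : 'rV[R]_n.+1 -> R) : boxed f ->
  bfs2 leb (lebesgue_rV R n) (f \o @rV_cons R n).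
Proof.
move=> [mf [A [M [mA fM]]]]; split.
  exact: measurableT_comp (@measurable_rV_cons R n).
exists (A ord0), (rV_box (fun i => A (lift ord0 i))), M; split => //.
- split; first by apply: measurable_rV_box => i; case: (mA (lift ord0 i)).
  exact: lebesgue_rV_box_fin.
- by move=> p; rewrite -indic_rV_box_cons; exact: fM.
Qed.

Lemma boxed_integral n (f : 'rV[R]_n.+1 -> R) : boxed f ->
  boxed (fun X : 'rV[R]_n => \int[leb]_x f (rV_cons (x, X))).
Proof.
move=> bf; have bc := boxed_cons bf.
move: (bf) => [mf [A [M [mA fM]]]]; split.
  by case: (bfs2_int1 bc).
exists (fun i => A (lift ord0 i)), (M * fine (leb (A ord0))); split => // X.
have [mA0 A0fin] := mA ord0.
have bA0 : bfs leb (\1_(A ord0) : RT -> R) by exact: bfs_indic.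
rewrite mulrAC -(Rintegral_indic leb mA0) -bfs_RintegralZ//.
apply: bfs_normr_Rintegral; [exact: bfs2_slice1 bc|exact: bfsZ|].
move=> x; rewrite (le_trans (fM _))// indic_rV_box_cons/= mulrA mulrAC.
by [].
Qed.

Lemma Rintegral_rV_cons n (f : 'rV[R]_n.+1 -> R) : boxed f ->
  \int[lebesgue_rV R n.+1]_X f X =
  \int[lebesgue_rV R n]_X \int[leb]_x f (rV_cons (x, X)).
Proof.
move=> bf; have bc := boxed_cons bf.
rewrite -(bfs2_Fubini1 bc).
have mf : measurable_fun [set: 'rV[R]_n.+1] (EFin \o f).
  by apply/measurable_EFinP; case: bf.
have mc := @measurable_rV_cons R n.
have ic := bfs_integrable (bfs2_bfs bc).
rewrite /Rintegral; congr fine.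
rewrite -[RHS](integral_pushforward mc mf ic measurableT).
by apply: eq_measure_integral.
Qed.

Lemma boxed_slice2 n (f : 'rV[R]_n.+2 -> R) z : boxed f ->
  bfs2 leb leb (fun p : RT * RT => f (rV_cons (p.1, rV_cons (p.2, z)))).
Proof.
move=> [mf [A [M [mA fM]]]]; split.
  apply: measurableT_comp mf _; apply: measurableT_comp (@measurable_rV_cons R n.+1) _.
  apply: measurable_fun_pair => //.
  apply: measurableT_comp (@measurable_rV_cons R n) _.
  exact: measurable_fun_pair.
exists (A ord0), (A (lift ord0 ord0)), `|M|; split => // p.
rewrite (le_trans (fM _))// !indic_rV_box_cons/=.
rewrite (le_trans (ler_norm _))// normrM ler_wpM2l// ger0_norm ?mulr_ge0//.
by rewrite ler_wpM2l// ler_piMr// indicE lern1 leq_b1.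
Qed.

Lemma Rintegral_rV_cons2 n (f : 'rV[R]_n.+2 -> R) : boxed f ->
  \int[lebesgue_rV R n.+2]_X f X = \int[lebesgue_rV R n]_z
    \int[(leb \x leb)%E]_p f (rV_cons (p.1, rV_cons (p.2, z))).
Proof.
move=> bf; rewrite (Rintegral_rV_cons bf) (Rintegral_rV_cons (boxed_integral bf)).
apply: eq_Rintegral => z _.
by rewrite (bfs2_Fubini1 (boxed_slice2 z bf)).
Qed.

(* [g] is the limit of its values at grid points, and these take countably many
   values, each on a countable union of boxes. *)
Lemma continuous_measurable_rV n (g : 'rV[R]_n -> R) :
  continuous g -> measurable_fun [set: 'rV[R]_n] g.
Proof.
move=> cg.
pose grid (k : nat) (m : {ffun 'I_n -> int}) : 'rV[R]_n :=
  \row_i ((m i)%:~R / k.+1%:R).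
pose code (k : nat) (x : 'rV[R]_n) : {ffun 'I_n -> int} :=
  [ffun i => Num.floor (x ord0 i * k.+1%:R)].
apply: (measurable_fun_cvg (h := fun k x => g (grid k (code k x)))) => [k|x _].
  move=> _ Y mY; rewrite setTI.
  rewrite (_ : _ @^-1` _ = \bigcup_(m : {ffun 'I_n -> int})
      [set x | code k x = m /\ Y (g (grid k m))]); last first.
    apply/seteqP; split=> [x /= Yx|x /= [m _ [<-]]//].
    by exists (code k x).
  apply: countable_bigcupT_measurable => [|m]; first exact: countableP.
  have [Ym|nYm] := pselect (Y (g (grid k m))); last first.
    by rewrite (_ : [set _ | _] = set0)//; apply/seteqP; split => // x [].
  rewrite (_ : [set _ | _] = rV_box (fun i =>
      `[(m i)%:~R / k.+1%:R, (m i + 1)%:~R / k.+1%:R[%classic)).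
    by apply: measurable_rV_box => i; exact: measurable_itv.
  apply/seteqP; split=> [x /= [cx _] i|x /= h].
    rewrite /= in_itv/= ler_pdivrMr// ltr_pdivlMr//.
    by have := floor_itv (x ord0 i * k.+1%:R); rewrite -cx ffunE.
  split => //; apply/ffunP => i; rewrite ffunE; have := h i.
  by rewrite /= in_itv/= ler_pdivrMr// ltr_pdivlMr// => /floor_def.
suff cgrid : (fun k => grid k (code k x)) @ \oo --> x.
  exact: (cvg_comp _ _ cgrid (cg x)).
apply/cvg_ballP => e e0.
near=> k; split => // i j; rewrite ord1 mxE ffunE /ball/=.
have k0 : (0 : R) < k.+1%:R by rewrite ltr0n.
have -> : x 0 j - (Num.floor (x ord0 j * k.+1%:R))%:~R / k.+1%:R =
   (x ord0 j * k.+1%:R - (Num.floor (x ord0 j * k.+1%:R))%:~R) / k.+1%:R.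
  by rewrite mulrBl mulfK// gt_eqF.
have /andP[f1 f2] := floor_itv (x ord0 j * k.+1%:R).
rewrite ger0_norm; last by rewrite divr_ge0 ?subr_ge0// ltW.
rewrite (@le_lt_trans _ _ (1 / k.+1%:R))//.
  rewrite ler_wpM2r ?invr_ge0 ?(ltW k0)// lerBlDr; move: f2; rewrite intrD1.
  by rewrite addrC => /ltW.
rewrite div1r; near: k.
have := @cvg_harmonic R; move/cvgr0Pnorm_lt => /(_ e e0); apply: filterS => k /=.
by rewrite ger0_norm// invr_ge0.
Unshelve. all: by end_near. Qed.

End row_vectors.

(** * Test functions restricted to planes *)

Section norms.
Context d (T : measurableType d) (R : realType).
Variable mu : {measure set T -> \bar R}.

Lemma bfs_finite_norm2 (f : T -> R) : bfs mu f -> finite_norm mu 2%:E f.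
Proof.
move=> bf; rewrite /finite_norm unlock; apply: poweR_lty.
have bff : bfs mu (fun x => f x * f x).
  have [mf [D [M [mD Dfin fM]]]] := bf.
  apply: bfsMl bf => //; exists `|M| => x; rewrite (le_trans (fM x))//.
  rewrite (le_trans (ler_norm _))// normrM ler_piMr// normr_nat lern1.
  exact: leq_b1.
have /integrableP[_] := bfs_integrable bff; apply: le_lt_trans.
rewrite le_eqVlt; apply/orP; left; apply/eqP; apply: eq_integral => x _ /=.
by rewrite powR_mulrn// normrM -expr2.
Qed.

Lemma bounded_Lfun_oo (f : T -> R) (M : R) : measurable_fun [set: T] f ->
  (forall x, `|f x| <= M) -> f \in Lfun mu +oo%E.
Proof.
move=> mf fM; apply/andP; split; rewrite inE//= /finite_norm unlock.
case: ifPn => _; last exact: ltry.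
apply: (@le_lt_trans _ _ M%:E); last exact: ltry.
by apply/ess_supP; apply: nearW => x /=; rewrite lee_fin.
Qed.

End norms.

Section test_functions.
Variables (R : realType) (n : nat).
Notation RT := (measurableTypeR R).
Implicit Types (phi g : 'rV[R]_n.+2 -> R) (z : 'rV[R]_n).

Definition plane_point z (p : RT * RT) : 'rV[R]_n.+2 := rV_cons (p.1, rV_cons (p.2, z)).

Local Notation i0 := (ord0 : 'I_n.+2).
Local Notation i1 := (lift ord0 ord0 : 'I_n.+2).

Lemma measurable_plane_point z : measurable_fun [set: RT * RT] (plane_point z).
Proof.
apply: measurableT_comp (@measurable_rV_cons R n.+1) _.
apply: measurable_fun_pair => //.
apply: measurableT_comp (@measurable_rV_cons R n) _.
exact: measurable_fun_pair.
Qed.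

Lemma plane_pointP z (p : RT * RT) (i : 'I_n.+2) :
  plane_point z p ord0 i =
  if unlift ord0 i is Some j then
    if unlift ord0 j is Some k then z ord0 k else p.2
  else p.1.
Proof.
rewrite /plane_point; case: (unliftP ord0 i) => [j ->|->]; last by rewrite rV_cons0.
rewrite rV_consS; case: (unliftP ord0 j) => [k ->|->]; first by rewrite rV_consS.
by rewrite rV_cons0.
Qed.

Lemma plane_point_shift0 z (h x y : R) :
  plane_point z (h + x, y) = h *: delta_mx ord0 i0 + plane_point z (x, y).
Proof.
apply/rowP => i; rewrite plane_pointP mxE [X in _ = X + _]mxE [X in _ * X]mxE plane_pointP eqxx/=.
case: (unliftP ord0 i) => [j ->|->]; first by rewrite eq_sym (negbTE (neq_lift _ _)) mulr0 add0r.
by rewrite eqxx mulr1.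
Qed.

Lemma plane_point_shift1 z (h x y : R) :
  plane_point z (x, h + y) = h *: delta_mx ord0 i1 + plane_point z (x, y).
Proof.
apply/rowP => i; rewrite plane_pointP mxE [X in _ = X + _]mxE [X in _ * X]mxE plane_pointP eqxx/=.
case: (unliftP ord0 i) => [j ->|->]; last by rewrite (negbTE (neq_lift _ _)) mulr0 add0r.
rewrite (inj_eq lift_inj); case: (unliftP ord0 j) => [k ->|->].
  by rewrite eq_sym (negbTE (neq_lift _ _)) mulr0 add0r.
by rewrite eqxx mulr1.
Qed.

Lemma compact_support_bounded (S : set 'rV[R]_n.+2) g : compact S -> continuous g ->
  (forall x, ~ S x -> g x = 0) -> exists B, forall x, `|g x| <= B.
Proof.
move=> cS cg g0.
have : bounded_set (g @` S).
  by apply: compact_bounded; apply: continuous_compact => //; exact: continuous_subspaceT.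
case=> M [_ /(_ (M + 1))]; rewrite ltrDl ltr01 => /(_ isT) MS.
exists (`|M| + 1) => x; have [Sx|nSx] := pselect (S x).
  have gSx : (g @` S) (g x) by exists x.
  by rewrite (le_trans (MS _ gSx))// lerD2r ler_norm.
by rewrite g0// normr0 addr_ge0.
Qed.

Lemma partial_support phi i x : ~ closure [set x | phi x != 0] x -> partial i phi x = 0.
Proof.
move=> nS; rewrite /partial.
have cS : closed (closure [set x | phi x != 0]) by exact: closed_closure.
have : \forall y \near x, phi y = cst 0 y.
  have : nbhs x (~` closure [set x | phi x != 0]).
    by apply: open_nbhs_nbhs; split => //; exact: closed_openC.
  apply: filterS => y nSy; apply/eqP; apply: contrapT => /negP py; apply: nSy.
  exact: subset_closure.
move=> /near_eq_derive ->; exact: derive_cst.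
Qed.

Lemma continuous_plane1 g z (y : R) : continuous g ->
  continuous (fun t : R => g (plane_point z (t, y))).
Proof.
move=> cg x; apply: (@continuous_comp _ _ _ (fun t : R => plane_point z (t, y)) g); last exact: cg.
have -> : (fun t : R => plane_point z (t, y)) =
    (fun t => t *: (delta_mx ord0 i0 : 'rV[R]_n.+2) + plane_point z (0, y)).
  by apply/funext => t; rewrite -plane_point_shift0 addr0.
apply: continuousD; last exact: cst_continuous.
exact: scalel_continuous.
Qed.

Lemma continuous_plane2 g z (x : R) : continuous g ->
  continuous (fun t : R => g (plane_point z (x, t))).
Proof.
move=> cg y; apply: (@continuous_comp _ _ _ (fun t : R => plane_point z (x, t)) g); last exact: cg.
have -> : (fun t : R => plane_point z (x, t)) =
    (fun t => t *: (delta_mx ord0 i1 : 'rV[R]_n.+2) + plane_point z (x, 0)).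
  by apply/funext => t; rewrite -plane_point_shift1 addr0.
apply: continuousD; last exact: cst_continuous.
exact: scalel_continuous.
Qed.

(** The difference quotient in one variable and the directional one are the same function of the
    increment. *)
Lemma is_derive_plane1 phi z (x y : R) :
  derivable phi (plane_point z (x, y)) (delta_mx ord0 i0) ->
  is_derive x (1 : R) (fun t : R => phi (plane_point z (t, y)))
    (partial i0 phi (plane_point z (x, y))).
Proof.
have E : (fun h : R => h^-1 *: (((fun t : R => phi (plane_point z (t, y))) \o shift x) (h *: 1) -
    phi (plane_point z (x, y)))) =
  (fun h : R => h^-1 *: ((phi \o shift (plane_point z (x, y))) (h *: delta_mx ord0 i0) -
    phi (plane_point z (x, y)))).
  by apply/funext => h /=; rewrite [h *: 1]mulr1 plane_point_shift0.
by move=> dphi; split; [move: dphi; rewrite /derivable -E|rewrite /partial /derive -E].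
Qed.

Lemma is_derive_plane2 phi z (x y : R) :
  derivable phi (plane_point z (x, y)) (delta_mx ord0 i1) ->
  is_derive y (1 : R) (fun t : R => phi (plane_point z (x, t)))
    (partial i1 phi (plane_point z (x, y))).
Proof.
have E : (fun h : R => h^-1 *: (((fun t : R => phi (plane_point z (x, t))) \o shift y) (h *: 1) -
    phi (plane_point z (x, y)))) =
  (fun h : R => h^-1 *: ((phi \o shift (plane_point z (x, y))) (h *: delta_mx ord0 i1) -
    phi (plane_point z (x, y)))).
  by apply/funext => h /=; rewrite [h *: 1]mulr1 plane_point_shift1.
by move=> dphi; split; [move: dphi; rewrite /derivable -E|rewrite /partial /derive -E].
Qed.

Lemma test_function_bounded phi : test_function phi -> exists B,
  forall X, [/\ `|phi X| <= B, `|partial i0 phi X| <= B & `|partial i1 phi X| <= B].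
Proof.
move=> [smth cS].
have cphi : continuous phi by have [] := smth [::].
have c0 : continuous (partial i0 phi) by have [] := smth [:: i0].
have c1 : continuous (partial i1 phi) by have [] := smth [:: i1].
have [B hB] : exists B, forall X, `|phi X| <= B.
  apply: (compact_support_bounded cS cphi) => X nS.
  by apply/eqP; apply: contrapT => /negP pX; apply: nS; exact: subset_closure.
have [B0 hB0] := compact_support_bounded cS c0 (@partial_support phi i0).
have [B1 hB1] := compact_support_bounded cS c1 (@partial_support phi i1).
have pos (C : R) (g : 'rV[R]_n.+2 -> R) : (forall X, `|g X| <= C) -> 0 <= C.
  by move=> /(_ 0); exact: le_trans.
exists (B + B0 + B1) => X.
have := hB X; have := hB0 X; have := hB1 X.
have := pos _ _ hB; have := pos _ _ hB0; have := pos _ _ hB1.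
by move=> *; split; lra.
Qed.

Lemma test_function_C1_bounded phi z : test_function phi -> exists B,
  C1_bounded B (fun p => phi (plane_point z p))
    (fun p => partial i0 phi (plane_point z p))
    (fun p => partial i1 phi (plane_point z p)).
Proof.
move=> tphi; have [B hB] := test_function_bounded tphi.
have [smth _] := tphi.
have [cphi dphi] := smth [::].
have c0 : continuous (partial i0 phi) by have [] := smth [:: i0].
have c1 : continuous (partial i1 phi) by have [] := smth [:: i1].
have mp := measurable_plane_point z.
exists B; split.
- exact: measurableT_comp (continuous_measurable_rV cphi) mp.
- exact: measurableT_comp (continuous_measurable_rV c0) mp.
- exact: measurableT_comp (continuous_measurable_rV c1) mp.
- by move=> x y; apply: is_derive_plane1; exact: dphi.
- by move=> x y; apply: is_derive_plane2; exact: dphi.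
- by move=> y; exact: continuous_plane1.
- by move=> x; exact: continuous_plane2.
- by move=> p; case: (hB (plane_point z p)).
- by move=> p; case: (hB (plane_point z p)).
- by move=> p; case: (hB (plane_point z p)).
Qed.

End test_functions.

(** * Essential skew-adjointness *)

Section L2_theory.
Context d (T : measurableType d) (R : realType).
Variable mu : {measure set T -> \bar R}.
Local Notation L2 := (LspaceType2 mu).
Local Notation RT := (measurableTypeR R).

Lemma L2_measurable (f : L2) : measurable_fun [set: T] (f : T -> R).
Proof. exact: (@measurable_funPT _ _ T RT (repr (f : {mfun_ mu, T >-> RT}))). Qed.

Lemma L2_finite_norm (f : L2) : finite_norm mu 2%:E (f : T -> R).
Proof. exact: (@Lebesgue_finite _ _ _ _ _ _ f). Qed.

(** An element of L^2 is a class that coerces to a chosen representative. This agrees with [f] only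
    almost everywhere, and the finiteness of the norm has to be carried over to it. *)
Lemma L2_class (f : T -> R) : measurable_fun [set: T] f -> finite_norm mu 2%:E f ->
  exists F : L2, (F : T -> R) = f %[ae mu].
Proof.
move=> mf ff.
pose fm : {mfun T >-> RT} := HB.pack f (isMeasurableFun.Build _ _ T RT f mf).
pose q : {mfun_ mu, T >-> RT} := (\pi_(aeEqMfun RT mu) fm)%qT.
have qf : (q : T -> R) = f %[ae mu].
  have : (repr q == fm %[mod aeEqMfun RT mu])%qT by rewrite reprK.
  by rewrite eqmodE => /asboolP.
have mq : measurable_fun [set: T] (q : T -> R).
  exact: (@measurable_funPT _ _ T RT (repr q)).
have qfin : finite_norm mu 2%:E (q : T -> R).
  move: ff; rewrite /finite_norm unlock.
  rewrite (@ae_eq_integral _ _ _ mu setT (fun x => `|(EFin \o q) x| `^ 2)%E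
    (fun x => `|(EFin \o f) x| `^ 2)%E)//.
  - apply: (measurableT_comp (measurable_poweR _)); apply: measurableT_comp => //.
    exact/measurable_EFinP.
  - apply: (measurableT_comp (measurable_poweR _)); apply: measurableT_comp => //.
    exact/measurable_EFinP.
  - by apply: filterS qf => x /= h _; rewrite h.
exists (LebesgueSpace.Pack (LebesgueSpace.Class
  (isFinLebesgue.Build _ _ _ mu 2%:E (lee1n 2) q qfin))).
exact: qf.
Qed.

Lemma L2_Lfun (f : L2) : (f : T -> R) \in Lfun mu 2%:E.
Proof.
apply/andP; split; rewrite inE/=; first exact: L2_measurable.
exact: L2_finite_norm.
Qed.

Lemma L2_inner_integrable (f g : L2) :
  mu.-integrable [set: T] (fun x => ((f x : R) * g x)%:E).
Proof.
by apply/Lfun1_integrable; apply: Lfun2_mul_Lfun1; exact: L2_Lfun.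
Qed.

Lemma L2_innerE (f g : L2) (f0 g0 : T -> R) :
    measurable_fun [set: T] f0 -> measurable_fun [set: T] g0 ->
    (f : T -> R) = f0 %[ae mu] -> (g : T -> R) = g0 %[ae mu] ->
  L2_inner f g = \int[mu]_x (f0 x * g0 x).
Proof.
move=> mf0 mg0 ff0 gg0; congr fine; apply: ae_eq_integral => //.
- by apply/measurable_EFinP; apply: measurable_funM; exact: L2_measurable.
- by apply/measurable_EFinP; apply: measurable_funM.
- by apply: filterS2 ff0 gg0 => x /= h1 h2 _; rewrite h1// h2.
Qed.

(** The Cauchy-Schwarz inequality, as the case of exponents 2 and 2 of Hoelder's inequality. *)
Lemma L2_inner_cvg (u : nat -> L2) (f g : L2) : L2_cvg u f ->
  L2_inner (u n) g @[n --> \oo] --> L2_inner f g.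
Proof.
move=> uf; have gfin : Lnorm mu 2%:E (EFin \o g) \is a fin_num.
  by rewrite ge0_fin_numE ?Lnorm_ge0//; exact: L2_finite_norm.
have bound n : (`|L2_inner f g - L2_inner (u n) g|%:E <=
    Lnorm mu 2%:E (fun x => ((u n x : R) - f x)%:E) * Lnorm mu 2%:E (EFin \o g))%E.
  have mfu : measurable_fun [set: T] (fun x => (u n x : R) - f x).
    by apply: measurable_funB; exact: L2_measurable.
  rewrite /L2_inner distrC -RintegralB//; [|exact: L2_inner_integrable|exact: L2_inner_integrable].
  have ifg : mu.-integrable [set: T] (EFin \o (fun x => (u n x : R) * g x - (f x : R) * g x)).
    exact: integrableB (L2_inner_integrable _ _) (L2_inner_integrable _ _).
  rewrite EFin_normr_Rintegral//; apply: le_trans.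
    by apply: le_abse_integral => //; exact: measurable_int ifg.
  have := @hoelder _ _ _ mu (fun x => (u n x : R) - f x) (g : T -> R) 2 2 mfu
    (L2_measurable g).
  rewrite Lnorm1 => /(_ _ _ _)/(le_trans _); apply => //; last by rewrite [RHS]splitr !div1r.
  by under eq_integral do rewrite -mulrBl.
apply/cvgrPdist_le => e e0.
have := cvgeZl gfin uf; rewrite mule0 => /fine_cvgP[fn].
move=> /cvgrPdist_le/(_ e e0); apply: filterS2 fn => n /= fn.
rewrite sub0r normrN => h; rewrite -lee_fin (le_trans (bound n))// muleC -(fineK fn).
by rewrite lee_fin (le_trans _ h)// ler_norm.
Qed.

Lemma L2_zero : exists z : L2, (z : T -> R) = (fun=> 0) %[ae mu].
Proof.
apply: L2_class; first exact: measurable_cst.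
by rewrite /finite_norm Lnorm0.
Qed.

(* If A were essentially skew-adjoint, w would be a limit of elements f of the
   domain with A f -> 0; then <A f, u> = <f, w> would give <w, w> = 0. *)
Lemma not_essentially_skew_adjoint (A : L2_operator mu) (u w : L2) :
    L2_adjoint A (u, w) ->
    (forall f g, A (f, g) -> L2_inner g w = 0) ->
    L2_inner w w != 0 ->
  ~ essentially_skew_adjoint A.
Proof.
move=> Auw Aw w0 skew; have [z z0] := L2_zero.
have m0 : measurable_fun [set: T] (fun=> 0 : R) by exact: measurable_cst.
have innerz f : L2_inner f z = 0.
  rewrite (L2_innerE (L2_measurable f) m0 _ z0); last exact: nearW.
  by apply: Rintegral_eq0 => x; rewrite mulr0.
have : L2_adjoint A (w, z) by move=> f g Afg /=; rewrite innerz; exact: Aw Afg.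
(* Skewness places ([w], [h]) in the closure for some [h] whose opposite is the zero class. *)
rewrite skew => -[h [f_ [g_ [Afg fw gh]]] zh].
have h0 : (h : T -> R) = (fun=> 0) %[ae mu].
  by apply: filterS2 z0 zh => x /= h1 h2 _; apply/eqP; rewrite -oppr_eq0 -h2 ?h1.
have hu : L2_inner h u = 0.
  rewrite (L2_innerE m0 (L2_measurable u) h0); last exact: nearW.
  by apply: Rintegral_eq0 => x; rewrite mul0r.
have c1 := L2_inner_cvg (g := w) fw; have c2 := L2_inner_cvg (g := u) gh.
move: w0; rewrite -(cvg_lim _ c1)//= (_ : (fun n => _) = (fun n => L2_inner (g_ n) u)).
  by rewrite (cvg_lim _ c2)// hu eqxx.
by apply/funext => n; rewrite (Auw _ _ (Afg n)).
Qed.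

End L2_theory.

(** * The example *)

Section example.
Variables (R : realType) (n : nat).
Notation leb := (@lebesgue_measure R).
Notation RT := (measurableTypeR R).
Local Notation C1 := (@fat_cantor R 2).
Local Notation C2 := (@fat_cantor R 1).
Local Notation lebV := (lebesgue_rV R n.+2).
Local Notation i0 := (ord0 : 'I_n.+2).
Local Notation i1 := (lift ord0 ord0 : 'I_n.+2).
Implicit Types (X Y : 'rV[R]_n.+2) (z : 'rV[R]_n) (p : RT * RT) (s : RT * RT -> R).

Definition plane_coord X : RT * RT := (X ord0 i0, X ord0 i1).

Definition other_coord X : 'rV[R]_n := \row_i X ord0 (lift ord0 (lift ord0 i)).

Definition unit_cube : set 'rV[R]_n := rV_box (fun=> `[0, 1]%classic).

Lemma plane_coord_point z p : plane_coord (plane_point z p) = p.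
Proof. by case: p => x y; rewrite /plane_coord !plane_pointP unlift_none liftK unlift_none. Qed.

Lemma other_coord_point z p : other_coord (plane_point z p) = z.
Proof. by apply/rowP => i; rewrite mxE plane_pointP !liftK. Qed.

Lemma measurable_plane_coord : measurable_fun [set: 'rV[R]_n.+2] plane_coord.
Proof. by apply: measurable_fun_pair; exact: measurable_rV_coor. Qed.

Lemma measurable_other_coord : measurable_fun [set: 'rV[R]_n.+2] other_coord.
Proof.
apply: measurable_fun_rVP => i; under eq_fun do rewrite mxE.
exact: measurable_rV_coor.
Qed.

Lemma measurable_unit_cube : measurable unit_cube.
Proof. by apply: measurable_rV_box => i; exact: measurable_itv. Qed.

(** The field has no component along the other coordinates, so no derivative falls on the indicator
    function of the cube and its jump produces no divergence. For n = 0 the cube is the only point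
    of R^0. *)
Definition cube_ext (s : RT * RT -> R) X : R :=
  \1_unit_cube (other_coord X) * s (plane_coord X).

Lemma measurable_cube_ext s : measurable_fun [set: RT * RT] s ->
  measurable_fun [set: 'rV[R]_n.+2] (cube_ext s).
Proof.
move=> ms; apply: measurable_funM.
  apply: measurableT_comp measurable_other_coord.
  by apply: measurable_indic; exact: measurable_unit_cube.
exact: measurableT_comp measurable_plane_coord.
Qed.

(** The bound 3 is 1 + [lam] for [lam] = 2, the right end of the first cell of [C1]; it also covers
    [C2], the corner and the unit cube. *)
Lemma boxed_cube_ext s (g : 'rV[R]_n.+2 -> R) (M B : R) :
    measurable_fun [set: RT * RT] s -> measurable_fun [set: 'rV[R]_n.+2] g ->
    (forall p, `|s p| <= M) -> (forall X, `|g X| <= B) ->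
    (forall p, s p != 0 -> `|p.1| <= 3 /\ `|p.2| <= 3) ->
  boxed (fun X => g X * cube_ext s X).
Proof.
move=> ms mg sM gB s3; split.
  by apply: measurable_funM => //; exact: measurable_cube_ext.
have B0 : 0 <= B by exact: le_trans (gB 0).
have M0 : 0 <= M by exact: le_trans (sM (0, 0)).
exists (fun=> `[- 3, 3]%classic), (B * M); split.
  move=> i; split; first exact: measurable_itv.
  by rewrite [X in (X < _)%E]lebesgue_measure_itv; case: ifPn => _; rewrite ?ltry.
move=> X; rewrite /cube_ext normrM [X in _ * X]normrM.
have [->|/s3[x3 y3]] := eqVneq (s (plane_coord X)) 0.
  by rewrite normr0 !mulr0 !mulr_ge0.
rewrite [X in _ * (X * _)]ger0_norm// [X in X * `|s _|]indicE.
case: (boolP (_ \in unit_cube)) => [|_]; last by rewrite mul0r mulr0 !mulr_ge0.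
rewrite inE => cX; rewrite mul1r indicE mem_set.
  by rewrite mulr1 ler_pM.
move=> i /=; rewrite in_itv/= -ler_norml.
case: (unliftP ord0 i) => [j ->|-> //]; case: (unliftP ord0 j) => [k ->|-> //].
by have := cX k; rewrite /= mxE in_itv/= => /andP[h1 h2]; rewrite ger0_norm//; lra.
Qed.

Lemma cube_ext_point s z p : cube_ext s (plane_point z p) = \1_unit_cube z * s p.
Proof. by rewrite /cube_ext other_coord_point plane_coord_point. Qed.

Definition vortex_corner p : R := (corner C1 C2 1 2 (abs2 p))%:R.

Definition vortex X : 'rV[R]_n.+2 := \row_i (cube_ext vortex_corner X *
  (if unlift ord0 i is Some j then
     if unlift ord0 j is Some _ then 0
     else - (Num.sg (plane_coord X).1 * \1_(~` C1) `|(plane_coord X).1|)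
   else Num.sg (plane_coord X).2 * \1_(~` C2) `|(plane_coord X).2|)).

Lemma dotv_vortex X Y : dotv (vortex X) Y = cube_ext vortex_corner X *
  (Num.sg (plane_coord X).2 * \1_(~` C2) `|(plane_coord X).2| * Y ord0 i0 -
   Num.sg (plane_coord X).1 * \1_(~` C1) `|(plane_coord X).1| * Y ord0 i1).
Proof.
rewrite /dotv big_ord_recl big_ord_recl big1 => [|i _]; last first.
  by rewrite mxE !liftK mulr0 mul0r.
by rewrite !mxE unlift_none liftK unlift_none; ring.
Qed.

Lemma transport_vortex_point phi z p :
  dotv (vortex (plane_point z p)) (grad phi (plane_point z p)) =
  \1_unit_cube z * folded_flux (fun p => (corner C1 C2 1 2 p)%:R)
    (fun p => partial i0 phi (plane_point z p))
    (fun p => partial i1 phi (plane_point z p)) p.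
Proof.
rewrite dotv_vortex cube_ext_point plane_coord_point /folded_flux /vortex_corner.
by rewrite !mxE mulrA.
Qed.

Let C_sub (l x : R) : fat_cantor l x -> l <= 2 -> 0 < l -> `|x| <= 3.
Proof.
move=> Cx l2 l0; rewrite ger0_norm ?(ltW (fat_cantor_gt0 Cx))//.
by have := fat_cantor_le Cx; lra.
Qed.

Let corner_sub p : corner C1 C2 1 2 (abs2 p) -> `|p.1| <= 3 /\ `|p.2| <= 3.
Proof.
have l1 : (0 : R) < 1 by []. have l2 : (0 : R) < 2 by [].
move=> /and4P[]; rewrite /abs2/= => x0 x2 y0.
have := @gap_length_ge R C2 (measurable_fat_cantor _) _ `|p.2|.
rewrite leb_fat_cantor// => /(_ (lexx _)).
have := @gap_length_ge0 R C1 (measurable_fat_cantor _) _ _ `|p.1| (ltW x0).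
rewrite leb_fat_cantor// => /(_ _ (lexx _)).
by move=> /(_ (fun x Cx => ltW (fat_cantor_gt0 Cx))) *; split; lra.
Qed.

Let measurable_vortex_corner : measurable_fun [set: RT * RT] vortex_corner.
Proof.
apply: (@measurableT_comp _ _ _ _ _ _ (fun p => (corner C1 C2 1 2 p)%:R : R)).
  by apply: measurable_natb; apply: measurable_corner; rewrite ?leb_fat_cantor//;
    exact: measurable_fat_cantor.
exact: measurable_abs2.
Qed.

Let vortex_corner_le1 p : `|vortex_corner p| <= 1.
Proof. by rewrite /vortex_corner normr_nat lern1 leq_b1. Qed.

Let vortex_corner_sub p : vortex_corner p != 0 -> `|p.1| <= 3 /\ `|p.2| <= 3.
Proof.
rewrite /vortex_corner; case: (boolP (corner _ _ _ _ _)) => [/corner_sub//|].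
by rewrite eqxx.
Qed.

Let measurable_swirl (C : set R) (i : 'I_n.+2) : measurable (C : set RT) ->
  measurable_fun [set: 'rV[R]_n.+2] (fun X => Num.sg (X ord0 i) * \1_(~` C) `|X ord0 i| : R).
Proof.
move=> mC; apply: measurable_funM.
  by apply: measurableT_comp (measurable_rV_coor i); exact: measurable_sgr.
have : measurable_fun [set: RT] (fun x : RT => \1_(~` C) `|x| : R).
  apply: measurableT_comp; last exact: normr_measurable.
  by apply: measurable_indic; exact: measurableC.
move=> h; exact: measurableT_comp h (measurable_rV_coor i).
Qed.

Let measurable_vortex_coef (i : 'I_n.+2) : measurable_fun [set: 'rV[R]_n.+2]
  (fun X => vortex X ord0 i).
Proof.
under eq_fun do rewrite mxE; apply: measurable_funM.
  exact: measurable_cube_ext.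
case: (unliftP ord0 i) => [j _|_]; last first.
  by apply: measurable_swirl; exact: measurable_fat_cantor.
case: (unliftP ord0 j) => [k _|_]; first exact: measurable_cst.
apply: measurable_funN; apply: measurable_swirl; exact: measurable_fat_cantor.
Qed.

Let vortex_bound X (i : 'I_n.+2) : `|vortex X ord0 i| <= 1.
Proof.
rewrite mxE normrM mulr_ile1//.
  rewrite /cube_ext normrM mulr_ile1// indicE normr_nat lern1 leq_b1//.
by case: (unliftP ord0 i) => [j _|_]; [case: (unliftP ord0 j) => [k _|_]|];
  rewrite ?normrN ?normr0// normrM normr_sg indicE normr_nat mulr_ile1 ?lern1 ?leq_b1.
Qed.

Lemma Linfty_vortex : Linfty_field vortex.
Proof. by move=> i; apply: (@bounded_Lfun_oo _ _ _ _ _ 1). Qed.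

Lemma compactly_supported_vortex : compactly_supported vortex.
Proof.
have cbox : compact [set X : 'rV[R]_n.+2 | forall i, `[- 3, 3]%classic (X ord0 i)].
  exact: (@rV_compact R n.+2 (fun=> `[- 3, 3]%classic) (fun=> @segment_compact _ _ _)).
apply: (subclosed_compact _ cbox); first exact: closed_closure.
have clbox : closed [set X : 'rV[R]_n.+2 | forall i, `[- 3, 3]%classic (X ord0 i)].
  by apply: compact_closed cbox; exact: norm_hausdorff.
rewrite [X in _ `<=` X](closure_id _).1//; apply: closure_subset => X /= vX i.
have : cube_ext vortex_corner X != 0.
  apply: contraNneq vX => c0; apply/eqP/rowP => j.
  by rewrite !mxE c0 mul0r.
rewrite /cube_ext mulf_eq0 negb_or => /andP[cX /vortex_corner_sub[x3 y3]].
have {}cX : unit_cube (other_coord X).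
  by move: cX; rewrite indicE; case: (boolP (_ \in _)) => [|_]; rewrite ?eqxx// inE.
rewrite in_itv/= -ler_norml.
case: (unliftP ord0 i) => [j ->|-> //]; case: (unliftP ord0 j) => [k ->|-> //].
by have := cX k; rewrite /= mxE in_itv/= => /andP[h1 h2]; rewrite ger0_norm//; lra.
Qed.

Let measurable_transport phi : test_function phi ->
  measurable_fun [set: 'rV[R]_n.+2] (fun X => dotv (vortex X) (grad phi X)).
Proof.
move=> [smth _]; apply: measurable_sum => i; apply: measurable_funM => //.
under eq_fun do rewrite mxE; apply: continuous_measurable_rV.
by have [] := smth [:: i].
Qed.

Let transportE phi X : dotv (vortex X) (grad phi X) =
  (Num.sg (plane_coord X).2 * \1_(~` C2) `|(plane_coord X).2| * partial i0 phi X -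
   Num.sg (plane_coord X).1 * \1_(~` C1) `|(plane_coord X).1| * partial i1 phi X) *
  cube_ext vortex_corner X.
Proof. by rewrite dotv_vortex mulrC !mxE. Qed.

Let boxed_transport phi : test_function phi ->
  boxed (fun X => dotv (vortex X) (grad phi X)).
Proof.
move=> tphi; have [B hB] := test_function_bounded tphi.
have [smth _] := tphi.
have c0 : continuous (partial i0 phi) by have [] := smth [:: i0].
have c1 : continuous (partial i1 phi) by have [] := smth [:: i1].
under eq_fun do rewrite transportE.
apply: (@boxed_cube_ext _ _ 1 (B + B)) => //.
  apply: measurable_funB; apply: measurable_funM.
  - by apply: measurable_swirl; exact: measurable_fat_cantor.
  - exact: continuous_measurable_rV.
  - by apply: measurable_swirl; exact: measurable_fat_cantor.
  - exact: continuous_measurable_rV.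
move=> X; have [_ h0 h1] := hB X; rewrite (le_trans (ler_normB _ _))// lerD// normrM.
  by rewrite (le_trans _ h0)// ler_piMl// normrM normr_sg indicE normr_nat mulr_ile1 ?lern1 ?leq_b1.
by rewrite (le_trans _ h1)// ler_piMl// normrM normr_sg indicE normr_nat mulr_ile1 ?lern1 ?leq_b1.
Qed.

Lemma div_free_vortex : div_free vortex.
Proof.
move=> phi tphi; apply/eqP; rewrite oppr_eq0; apply/eqP.
rewrite (Rintegral_rV_cons2 (boxed_transport tphi)).
apply: Rintegral_eq0 => z; have [B Cphi] := test_function_C1_bounded z tphi.
under eq_Rintegral do rewrite -/(plane_point z _) transport_vortex_point.
rewrite bfs_RintegralZ ?(folded_flux_corner Cphi) ?mulr0//.
by apply: bfs2_bfs; apply: (bfs2_folded_flux Cphi); exact: bfs2_corner12.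
Qed.

(** [stopped_flow] and [stopped_sink] represent the elements u and w of L^2 with A^* u = w and A^* w
    = 0. *)
Definition stopped_flow X : R := cube_ext (fun p => upstream (abs2 p)) X.

Definition stopped_sink X : R := cube_ext (@sink R) X.

Let upstream_abs2_le1 p : `|upstream (abs2 p)| <= 1.
Proof.
rewrite ger0_norm ?upstream_ge0// (le_trans (upstream_le _))// lern1.
exact: leq_b1.
Qed.

Let sink_le1 p : `|@sink R p| <= 1.
Proof.
by rewrite /sink !normrM !normr_sg !indicE !normr_nat !mulr_ile1 ?mulr_ge0 ?lern1 ?leq_b1.
Qed.

Let measurable_upstream_abs2 : measurable_fun [set: RT * RT] (fun p => upstream (abs2 p) : R).
Proof. exact: measurableT_comp (@measurable_upstream R) (@measurable_abs2 R). Qed.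

Let measurable_sink : measurable_fun [set: RT * RT] (@sink R).
Proof. by case: (@bfs2_sink R). Qed.

Let sink_sub p : @sink R p != 0 -> `|p.1| <= 3 /\ `|p.2| <= 3.
Proof.
rewrite /sink !indicE mulf_eq0 negb_or => /andP[_]; rewrite mulf_eq0 negb_or.
case: (boolP (`|p.1| \in C1)) => [|_]; last by rewrite eqxx.
case: (boolP (`|p.2| \in C2)) => [|_]; last by rewrite eqxx andbF.
rewrite !inE => /C_sub h2 /C_sub h1 _; split.
  by rewrite -normr_id; exact: h1.
by rewrite -normr_id; apply: h2 => //; rewrite ler1n.
Qed.

Let boxed_stopped_flow (g : 'rV[R]_n.+2 -> R) : measurable_fun [set: 'rV[R]_n.+2] g ->
  (exists B, forall X, `|g X| <= B) -> boxed (fun X => g X * stopped_flow X).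
Proof.
move=> mg [B gB]; apply: (@boxed_cube_ext _ _ 1 B) => // p up.
apply: corner_sub; case: (boolP (corner _ _ _ _ _)) => // /negbTE c0.
have := upstream_le (abs2 p); rewrite c0 => h.
by move: up; rewrite (@le_anti _ _ (upstream (abs2 p)) 0) ?eqxx// h upstream_ge0.
Qed.

Let boxed_stopped_sink (g : 'rV[R]_n.+2 -> R) : measurable_fun [set: 'rV[R]_n.+2] g ->
  (exists B, forall X, `|g X| <= B) -> boxed (fun X => g X * stopped_sink X).
Proof. by move=> mg [B gB]; apply: (@boxed_cube_ext _ _ 1 B). Qed.

Lemma transport_stopped_flow phi : test_function phi ->
  \int[lebV]_X (dotv (vortex X) (grad phi X) * stopped_flow X) =
  \int[lebV]_X (phi X * stopped_sink X).
Proof.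
move=> tphi; have [B hB] := test_function_bounded tphi.
have cphi : continuous phi by have [smth _] := tphi; have [] := smth [::].
have b1 : boxed (fun X => dotv (vortex X) (grad phi X) * stopped_flow X).
  apply: boxed_stopped_flow; first exact: measurable_transport.
  have [_ [A [M [_ hM]]]] := boxed_transport tphi.
  exists `|M| => X; rewrite (le_trans (hM X))// (le_trans (ler_norm _))// normrM.
  by rewrite ler_piMr// indicE normr_nat lern1 leq_b1.
have b2 : boxed (fun X => phi X * stopped_sink X).
  apply: boxed_stopped_sink; first exact: continuous_measurable_rV.
  by exists B => X; case: (hB X).
rewrite (Rintegral_rV_cons2 b1) (Rintegral_rV_cons2 b2).
apply: eq_Rintegral => z _; have [B' Cphi] := test_function_C1_bounded z tphi.
transitivity (\int[(leb \x leb)%E]_p (\1_unit_cube z * folded_flux (@upstream R)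
    (fun p => partial i0 phi (plane_point z p))
    (fun p => partial i1 phi (plane_point z p)) p)).
  apply: eq_Rintegral => p _; rewrite -/(plane_point z p) transport_vortex_point.
  rewrite /stopped_flow cube_ext_point /folded_flux.
  rewrite -[X in _ = _ * (X * _)]upstream_corner indicE.
  by case: (z \in unit_cube); rewrite ?mul0r ?mul1r//; ring.
rewrite bfs_RintegralZ; last first.
  by apply: bfs2_bfs; apply: (bfs2_folded_flux Cphi); exact: bfs2_upstream.
rewrite (folded_flux_upstream Cphi) -bfs_RintegralZ; last first.
  apply: bfs2_bfs; under eq_fun do rewrite mulrC.
  apply: bfs2Ml (@bfs2_sink R); first exact: C1b_meas Cphi.
  by exists B'; exact: C1b_bound Cphi.
apply: eq_Rintegral => p _; rewrite -/(plane_point z p) /stopped_sink cube_ext_point.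
by ring.
Qed.

Lemma transport_stopped_sink phi X :
  dotv (vortex X) (grad phi X) * stopped_sink X = 0.
Proof.
rewrite transportE /stopped_sink /cube_ext /sink !indicE !in_setC.
case: (`|(plane_coord X).1| \in C1) => /=; last by rewrite !(mul0r, mulr0).
case: (`|(plane_coord X).2| \in C2) => /=; last by rewrite !(mul0r, mulr0).
by rewrite !mulr0 !mul0r subrr !mul0r.
Qed.

Let bounded_one : exists B : R, forall X : 'rV[R]_n.+2, `|cst (1 : R) X| <= B.
Proof. by exists 1 => X /=; rewrite normr1. Qed.

Let bfs_stopped_flow : bfs lebV stopped_flow.
Proof.
have := boxed_stopped_flow (g := cst 1) (measurable_cst _) bounded_one.
by move=> /boxed_bfs; under eq_fun do rewrite mul1r.
Qed.

Let bfs_stopped_sink : bfs lebV stopped_sink.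
Proof.
have := boxed_stopped_sink (g := cst 1) (measurable_cst _) bounded_one.
by move=> /boxed_bfs; under eq_fun do rewrite mul1r.
Qed.

(** The square is 1 on the product of [C1], [C2] and the unit cube, which has measure 1 because each
    of its factors does. *)
Lemma stopped_sink_gt0 : 0 < \int[lebV]_X (stopped_sink X * stopped_sink X).
Proof.
pose A (i : 'I_n.+2) : set RT := if unlift ord0 i is Some j then
  (if unlift ord0 j is Some _ then `[0, 1]%classic else C2) else C1.
have mA i : measurable (A i) /\ leb (A i) = 1%E.
  rewrite /A; case: (unlift ord0 i) => [j|]; last first.
    by split; [exact: measurable_fat_cantor|rewrite leb_fat_cantor].
  case: (unlift ord0 j) => [k|]; last first.
    by split; [exact: measurable_fat_cantor|rewrite leb_fat_cantor].
  split; first exact: measurable_itv.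
  by rewrite [LHS]lebesgue_measure_itv/= lte_fin ltr01 oppr0 adde0.
have mbox : measurable (rV_box A) by apply: measurable_rV_box => i; case: (mA i).
have box1 : lebV (rV_box A) = 1%E.
  rewrite [LHS]lebesgue_rV_box; last by move=> i; case: (mA i).
  by rewrite big1// => i _; case: (mA i).
apply: (@lt_le_trans _ _ (\int[lebV]_X (\1_(rV_box A) X))).
  by rewrite Rintegral_indic// [X in fine X]box1.
apply: bfs_le_Rintegral.
- by apply: bfs_indic => //; rewrite [X in (X < _)%E]box1 ltry.
- apply: bfsMl bfs_stopped_sink; first by case: bfs_stopped_sink.
  exists 1 => X; rewrite /stopped_sink /cube_ext normrM mulr_ile1// indicE normr_nat.
  by rewrite lern1 leq_b1.
move=> X; rewrite indicE; case: (boolP (X \in rV_box A)) => [|_]; last first.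
  by rewrite -expr2 sqr_ge0.
rewrite inE => AX.
have x1 : C1 (X ord0 i0) by have := AX i0; rewrite /A unlift_none.
have y1 : C2 (X ord0 i1) by have := AX i1; rewrite /A liftK unlift_none.
have z1 : unit_cube (other_coord X).
  by move=> k; have := AX (lift ord0 (lift ord0 k)); rewrite /A !liftK mxE.
have x0 := fat_cantor_gt0 x1; have y0 := fat_cantor_gt0 y1.
rewrite /stopped_sink /cube_ext /sink/= !gtr0_norm// !gtr0_sg// !indicE !mem_set//.
by rewrite !mulr1.
Qed.

Lemma vortex_not_essentially_skew_adjoint :
  ~ essentially_skew_adjoint (transport_operator vortex).
Proof.
have mf : measurable_fun [set: 'rV[R]_n.+2] stopped_flow by case: bfs_stopped_flow.
have ms : measurable_fun [set: 'rV[R]_n.+2] stopped_sink by case: bfs_stopped_sink.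
have [u uE] := L2_class mf (bfs_finite_norm2 bfs_stopped_flow).
have [w wE] := L2_class ms (bfs_finite_norm2 bfs_stopped_sink).
apply: (@not_essentially_skew_adjoint _ _ _ _ _ u w).
- move=> f g [phi [tphi fE gE]] /=.
  have mphi : measurable_fun [set: 'rV[R]_n.+2] phi.
    by apply: continuous_measurable_rV; have [smth _] := tphi; have [] := smth [::].
  rewrite (L2_innerE (measurable_transport tphi) mf gE uE).
  by rewrite (L2_innerE mphi ms fE wE); exact: transport_stopped_flow.
- move=> f g [phi [tphi fE gE]] /=.
  rewrite (L2_innerE (measurable_transport tphi) ms gE wE).
  by apply: Rintegral_eq0 => X; exact: transport_stopped_sink.
- by rewrite (L2_innerE ms ms wE wE) gt_eqF// stopped_sink_gt0.
Qed.

End example.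

Theorem proposition1p2 (R : realType) (d : nat) (hd : (2 <= d)%N) :
  exists v : 'rV[R]_d -> 'rV[R]_d,
    [/\ Linfty_field v, compactly_supported v, div_free v
      & ~ essentially_skew_adjoint (transport_operator v)].
Proof.
case: d hd => [//|[//|n]] _; exists (@vortex R n); split.
- exact: Linfty_vortex.
- exact: compactly_supported_vortex.
- exact: div_free_vortex.
- exact: vortex_not_essentially_skew_adjoint.
Qed.
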